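(* Let $(a_n)_{n\ge 1}$ be a sequence of quaternions with $|a_n|<1$ for all $n\ge1$ and $\sum_{n\ge 1}(1-|a_n|)=+\infty$. Let $(\mathbf{\Phi}_n)_{n\ge1}$ be the slice regular Malmquist–Takenaka system generated by $(a_n)_{n\ge1}$, and for $n\ge1$ and $f\in H^2(\mathbb{B})$ put $$P_nf(z)=\sum_{k=1}^n\mathbf{\Phi}_k(z)\,\langle f,\mathbf{\Phi}_k\rangle .$$ Then for every $f\in H^2(\mathbb{B})$, $\|f-P_nf\|\to0$ as $n\to\infty$, where $\|\cdot\|$ is the norm of $H^2(\mathbb{B})$, and $P_nf(z)\to f(z)$ uniformly on every compact subset of $\mathbb{B}$.
   Context: $\mathbb{H}$ is the skew field of quaternions with norm $|q|=\sqrt{q\overline q}$, $\mathbb{B}=\{q\in\mathbb{H}:|q|<1\}$, and $\mathbb{S}=\{q\in\mathbb{H}:q^2=-1\}$ is the sphere of imaginary units. For $I\in\mathbb{S}$, $L_I=\mathbb{R}+\mathbb{R}I$ and $\mathbb{B}_I=\mathbb{B}\cap L_I$. Slice regular functions: a function $f:\mathbb{B}\to\mathbb{H}$ is (slice) regular if for every $I\in\mathbb{S}$ its restriction $f_I$ to $\mathbb{B}_I$ has continuous partial derivatives and satisfies $\frac12\left(\frac{\partial}{\partial x}+I\frac{\partial}{\partial y}\right)f_I(x+yI)=0$; equivalently, $f(q)=\sum_{n\ge 0}q^na_n$ is a power series with coefficients $a_n\in\mathbb{H}$ converging on $\mathbb{B}$ (similarly on larger balls centered at $0$). For regular $f(q)=\sum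 q^na_n$, $g(q)=\sum q^nb_n$: - regular product: $(f\ast g)(q)=\sum_{n\ge 0}q^n\sum_{k=0}^na_kb_{n-k}$ (associative, generally non-commutative); - regular conjugate: $f^c(q)=\sum_{n\ge 0}q^n\overline{a_n}$; symmetrization: $f^s=f\ast f^c=f^c\ast f$; - regular reciprocal: $f^{-\ast}=(f^s)^{-1}f^c$ (where $f^s\neq 0$). For $a\in\mathbb{B}$ the regular Blaschke function is $\mathcal{B}_a(q)=(1-q\overline a)^{-\ast}\ast(q-a)$. Hardy space: $H^2(\mathbb{B})$ is the space of regular $f:\mathbb{B}\to\mathbb{H}$, $f(q)=\sum_{n\ge0}q^na_n$, with $\|f\|^2=\sum_{n\ge 0}|a_n|^2<\infty$, with inner product, for $g(q)=\sum_{n\ge 0} q^nb_n$, $$\langle f,g\rangle=\sum_{n\ge 0}\overline{b_n}a_n=\lim_{r\to1^-}\frac1{2\pi}\int_0^{2\pi}\overline{g(re^{I\theta})}f(re^{I\theta})\,d\theta\quad\text{for any } I\in\mathbb{S}.$$ Slice regular Malmquist–Takenaka system generated by a sequence $(a_n)_{n\ge1}$ in $\mathbb{B}$: $$\mathbf{\Phi}_1(z)=\sqrt{1-|a_1|^2}\,(1-z\overline{a_1})^{-\ast},$$ $$\mathbf{\Phi}_n(z)=\sqrt{1-|a_n|^2}\,\bigl(\mathcal{B}_{a_1}\ast\mathcal{B}_{a_2}\ast\cdots\ast\mathcal{B}_{a_{n-1}}\bigr)(z)\ast(1-z\overline{a_n})^{-\ast}\quad(n\ge2).$$ *)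

(* Defs.v *)
From HB Require Import structures.
From mathcomp Require Import all_boot all_order all_algebra.
From mathcomp Require Import ring lra.
From mathcomp Require Import all_classical all_reals all_analysis.

Set Implicit Arguments.
Unset Strict Implicit.
Unset Printing Implicit Defensive.

Import Order.TTheory GRing.Theory Num.Theory.
Import numFieldNormedType.Exports.

Local Open Scope classical_set_scope.
Local Open Scope ring_scope.

(* Quat x0 x1 x2 x3 stands for x0 + x1 i + x2 j + x3 k. *)
Record quat (R : Type) := Quat { qRe : R; qI : R; qJ : R; qK : R }.

Section quaternion_structures.
Variable R : realType.
Local Notation H := (quat R).

Definition quat_to_prod (q : H) : R * R * R * R := (qRe q, qI q, qJ q, qK q).
Definition quat_of_prod (p : R * R * R * R) : H :=
  Quat p.1.1.1 p.1.1.2 p.1.2 p.2.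
Lemma quat_to_prodK : cancel quat_to_prod quat_of_prod.
Proof. by case. Qed.

HB.instance Definition _ := Choice.copy H (can_type quat_to_prodK).

Definition qadd (p q : H) : H :=
  Quat (qRe p + qRe q) (qI p + qI q) (qJ p + qJ q) (qK p + qK q).
Definition qopp (p : H) : H := Quat (- qRe p) (- qI p) (- qJ p) (- qK p).

Lemma qaddA : associative qadd.
Proof. by case=> ? ? ? ? [? ? ? ?] [? ? ? ?]; congr Quat; rewrite /= addrA. Qed.
Lemma qaddC : commutative qadd.
Proof. by case=> ? ? ? ? [? ? ? ?]; congr Quat; rewrite /= addrC. Qed.
Lemma qadd0 : left_id (Quat 0 0 0 0 : H) qadd.
Proof. by case=> ? ? ? ?; congr Quat; rewrite /= add0r. Qed.
Lemma qaddN : left_inverse (Quat 0 0 0 0 : H) qopp qadd.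
Proof. by case=> ? ? ? ?; congr Quat; rewrite /= addNr. Qed.

HB.instance Definition _ := GRing.isZmodule.Build H qaddA qaddC qadd0 qaddN.

Definition qmul (p q : H) : H :=
  let: Quat a b c d := p in let: Quat a' b' c' d' := q in
  Quat (a * a' - b * b' - c * c' - d * d')
       (a * b' + b * a' + c * d' - d * c')
       (a * c' - b * d' + c * a' + d * b')
       (a * d' + b * c' - c * b' + d * a').

Lemma qmulA : associative qmul.
Proof. by case=> ? ? ? ? [? ? ? ?] [? ? ? ?]; congr Quat; ring. Qed.
Lemma qmul1l : left_id (Quat 1 0 0 0 : H) qmul.
Proof. by case=> ? ? ? ?; congr Quat; ring. Qed.
Lemma qmul1r : right_id (Quat 1 0 0 0 : H) qmul.
Proof. by case=> ? ? ? ?; congr Quat; ring. Qed.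
Lemma qmulDl : left_distributive qmul +%R.
Proof. by case=> ? ? ? ? [? ? ? ?] [? ? ? ?]; congr Quat; rewrite /=; ring. Qed.
Lemma qmulDr : right_distributive qmul +%R.
Proof. by case=> ? ? ? ? [? ? ? ?] [? ? ? ?]; congr Quat; rewrite /=; ring. Qed.
Lemma quat1_neq0 : (Quat 1 0 0 0 : H) != 0.
Proof. by apply/eqP => -[/eqP]; rewrite oner_eq0. Qed.

HB.instance Definition _ := GRing.Zmodule_isNzRing.Build H
  qmulA qmul1l qmul1r qmulDl qmulDr quat1_neq0.

Definition qscale (t : R) (q : H) : H :=
  Quat (t * qRe q) (t * qI q) (t * qJ q) (t * qK q).

Lemma qscaleA a b q : qscale a (qscale b q) = qscale (a * b) q.
Proof. by congr Quat; rewrite /= mulrA. Qed.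
Lemma qscale1 : left_id 1 qscale.
Proof. by case=> ? ? ? ?; congr Quat; rewrite /= mul1r. Qed.
Lemma qscaleDr : right_distributive qscale +%R.
Proof. by move=> ? [? ? ? ?] [? ? ? ?]; congr Quat; rewrite /= mulrDr. Qed.
Lemma qscaleDl q : {morph qscale^~ q : a b / a + b}.
Proof. by move=> a b; congr Quat; rewrite /= mulrDl. Qed.

HB.instance Definition _ := GRing.Zmodule_isLmodule.Build R H
  qscaleA qscale1 qscaleDr qscaleDl.

Lemma qscaleAl (t : R) (p q : H) : t *: (p * q) = (t *: p) * q.
Proof. by case: p q => ? ? ? ? [? ? ? ?]; congr Quat; rewrite /=; ring. Qed.

HB.instance Definition _ := GRing.Lmodule_isLalgebra.Build R H qscaleAl.

Lemma qscaleAr (t : R) (p q : H) : t *: (p * q) = p * (t *: q).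
Proof. by case: p q => ? ? ? ? [? ? ? ?]; congr Quat; rewrite /=; ring. Qed.

HB.instance Definition _ := GRing.Lalgebra_isAlgebra.Build R H qscaleAr.

Definition qconj (q : H) : H := Quat (qRe q) (- qI q) (- qJ q) (- qK q).

(* q * qconj q is real, so it is faithfully represented by its real part. *)
Definition qnorm (q : H) : R := Num.sqrt (qRe (q * qconj q)).

Let sqn (q : H) : R := qRe q ^+ 2 + qI q ^+ 2 + qJ q ^+ 2 + qK q ^+ 2.

Let sqn_ge0 q : 0 <= sqn q.
Proof. by rewrite /sqn !addr_ge0 ?sqr_ge0. Qed.

Let qnormE q : qnorm q = Num.sqrt (sqn q).
Proof. by case: q => a b c d; congr Num.sqrt; rewrite /sqn /=; ring. Qed.

Let sqn_eq0 q : sqn q = 0 -> q = 0.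
Proof.
case: q => a b c d; rewrite /sqn /= => /eqP.
rewrite !paddr_eq0 ?addr_ge0 ?sqr_ge0// !sqrf_eq0.
by move=> /andP[/andP[/andP[/eqP-> /eqP->] /eqP->] /eqP->].
Qed.

Lemma qnormD p q : qnorm (p + q) <= qnorm p + qnorm q.
Proof.
rewrite !qnormE.
have s0 : 0 <= Num.sqrt (sqn p) + Num.sqrt (sqn q) by rewrite addr_ge0 ?sqrtr_ge0.
rewrite -[leRHS]ger0_norm// -sqrtr_sqr ler_sqrt ?sqr_ge0//.
rewrite sqrrD !sqr_sqrtr// -sqrtrM//.
pose d := qRe p * qRe q + qI p * qI q + qJ p * qJ q + qK p * qK q.
have -> : sqn (p + q) = sqn p + d *+ 2 + sqn q by rewrite /sqn /d /=; ring.
rewrite lerD2r lerD2l lerMn2r orFb; apply: le_trans (ler_norm _) _.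
rewrite -sqrtr_sqr ler_sqrt ?mulr_ge0// -subr_ge0.
case: p q @d s0 => a b c e [a' b' c' e'] d _.
have -> : sqn (Quat a b c e) * sqn (Quat a' b' c' e') - d ^+ 2 =
  (a * b' - b * a') ^+ 2 + (a * c' - c * a') ^+ 2 + (a * e' - e * a') ^+ 2 +
  (b * c' - c * b') ^+ 2 + (b * e' - e * b') ^+ 2 + (c * e' - e * c') ^+ 2.
  by rewrite /sqn /d /=; ring.
by rewrite !addr_ge0 ?sqr_ge0.
Qed.

Lemma qnormZ (t : R) (q : H) : qnorm (t *: q) = `|t| * qnorm q.
Proof.
rewrite !qnormE -sqrtr_sqr -sqrtrM ?sqr_ge0//; congr Num.sqrt.
by rewrite /sqn /=; ring.
Qed.

Lemma qnorm_eq0 (q : H) : qnorm q = 0 -> q = 0.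
Proof.
rewrite qnormE => /eqP; rewrite sqrtr_eq0 => s0.
by apply: sqn_eq0; apply/eqP; rewrite eq_le s0 sqn_ge0.
Qed.

HB.instance Definition _ := Lmodule_isNormed.Build R H qnormD qnormZ qnorm_eq0.

Definition qinv (q : H) : H := (qRe (q * qconj q))^-1 *: qconj q.

Let qmulC q : q * qconj q = (sqn q)%:A.
Proof. by case: q => a b c d; congr Quat; rewrite /sqn /=; ring. Qed.
Let qCmul q : qconj q * q = (sqn q)%:A.
Proof. by case: q => a b c d; congr Quat; rewrite /sqn /=; ring. Qed.
Let qReA (t : R) : qRe (t%:A : H) = t.
Proof. by rewrite /= mulr1. Qed.
Let sqn_neq0 q : q != 0 -> sqn q != 0.
Proof. by apply: contraNN => /eqP/sqn_eq0->. Qed.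

Lemma qmulVq : {in predC1 (0 : H), left_inverse 1 qinv *%R}.
Proof.
move=> q q0; rewrite /qinv qmulC qReA -scalerAl qCmul scalerA mulVf ?scale1r//.
exact: sqn_neq0.
Qed.

Lemma qmulqV : {in predC1 (0 : H), right_inverse 1 qinv *%R}.
Proof.
move=> q q0; rewrite /qinv qmulC qReA -scalerAr qmulC scalerA mulVf ?scale1r//.
exact: sqn_neq0.
Qed.

Lemma qunitP (p q : H) : q * p = 1 /\ p * q = 1 -> predC1 0 p.
Proof.
move=> [_ qp] /=; apply: contra_eq_neq qp => ->.
by rewrite mul0r eq_sym oner_eq0.
Qed.

Lemma qinv_out : {in [predC predC1 (0 : H)], qinv =1 id}.
Proof.
move=> q; rewrite !inE negbK => /eqP ->.
by congr Quat; rewrite /= ?oppr0 mulr0.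
Qed.

HB.instance Definition _ :=
  GRing.NzRing_hasMulInverse.Build H qmulVq qmulqV qunitP qinv_out.

End quaternion_structures.

Section slice_regular.
Variable R : realType.
Local Notation H := (quat R).

Definition qball : set H := [set q | `|q| < 1].

Definition imag_units : set H := [set I | I ^+ 2 = - 1].

(* Functions on the unit ball are total functions H -> H of which only the
   values on qball matter. *)
Definition slice_regular (f : H -> H) : Prop :=
  forall I, imag_units I ->
  let disc := [set p : R * R | qball (p.1%:A + p.2 *: I)] in
  let fI (p : R * R) := f (p.1%:A + p.2 *: I) in
  let dx (p : R * R) := derive1 (fun t : R => fI (t, p.2)) p.1 in
  let dy (p : R * R) := derive1 (fun t : R => fI (p.1, t)) p.2 in
  [/\ forall p, disc p -> derivable (fun t : R => fI (t, p.2)) p.1 1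
        /\ derivable (fun t : R => fI (p.1, t)) p.2 1,
      forall p, disc p -> {for p, continuous dx} /\ {for p, continuous dy} &
      forall p, disc p -> 2^-1 *: (dx p + I * dy p) = 0].

Definition pseries (a : nat -> H) (q : H) : H :=
  lim (series (fun n => q ^+ n * a n) @ \oo).

Definition has_expansion (f : H -> H) (a : nat -> H) : Prop :=
  forall q, qball q -> series (fun n => q ^+ n * a n) @ \oo --> f q.

(* The coefficients of f, which are unique when they exist. *)
Definition coef (f : H -> H) : nat -> H :=
  xget (fun=> 0) [set a | has_expansion f a].

Definition rmul (f g : H -> H) : H -> H :=
  pseries (fun n => \sum_(k < n.+1) coef f k * coef g (n - k)).

Definition rconj (f : H -> H) : H -> H := pseries (fun n => qconj (coef f n)).

Definition rsym (f : H -> H) : H -> H := rmul f (rconj f).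

Definition rrec (f : H -> H) : H -> H := fun q => (rsym f q)^-1 * rconj f q.

(* The kernel (1 - q \bar a)^{-*}. *)
Definition szego (a : H) : H -> H := rrec (fun q => 1 - q * qconj a).

Definition blaschke (a : H) : H -> H := rmul (szego a) (fun q => q - a).

Definition hardy2 (f : H -> H) : Prop :=
  slice_regular f /\
  exists2 a, has_expansion f a &
    (\sum_(0 <= n <oo) (`|a n| ^+ 2)%:E < +oo)%E.

Definition hardy2_dot (f g : H -> H) : H :=
  lim (series (fun n => qconj (coef g n) * coef f n) @ \oo).

(* Extended to be +oo on functions that are not sums of a power series with
   square-summable coefficients, so that finiteness (in particular convergence
   to 0) is meaningful. *)
Definition hardy2_norm (f : H -> H) : \bar R :=
  if `[< exists a, has_expansion f a >]
  then poweR (\sum_(0 <= n <oo) (`|coef f n| ^+ 2)%:E) 2^-1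
  else +oo%E.

(* Indexed from 1: the values a 0 and malmquist_takenaka a 0 are irrelevant.
   For n >= 2 the foldl is B_{a_1} * B_{a_2} * ... * B_{a_{n-1}}. *)
Definition malmquist_takenaka (a : nat -> H) (n : nat) : H -> H :=
  let c := Num.sqrt (1 - `|a n| ^+ 2) in
  if (n <= 1)%N then fun z => c *: szego (a n) z
  else fun z => c *: rmul
    (foldl rmul (blaschke (a 1%N)) [seq blaschke (a k) | k <- index_iota 2 n])
    (szego (a n)) z.

Definition mt_proj (a : nat -> H) (n : nat) (f : H -> H) : H -> H := fun z =>
  \sum_(1 <= k < n.+1)
    malmquist_takenaka a k z * hardy2_dot f (malmquist_takenaka a k).

End slice_regular.

(* Main.v *)
Require Import Defs.
From mathcomp Require Import all_boot all_order all_algebra.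
From mathcomp Require Import ring lra zify.
From mathcomp Require Import all_classical all_reals all_analysis.

Import Order.TTheory GRing.Theory Num.Theory.
Import numFieldNormedType.Exports.

Local Open Scope classical_set_scope.
Local Open Scope ring_scope.

(** Identifying a function of the Hardy space with its coefficient sequence turns
    the regular product into the Cauchy product [cprod] and the norm into that of
    square-summable sequences, so the proof takes place among sequences.

    One Blaschke factor is treated as a lossless linear system. If two sequences
    f, g are read off a state s that tends to zero by
      f n = s n - a * s (n+1)   and   g n = s (n+1) - conj a * s n,
    then |f n|^2 - |g n|^2 = (1 - |a|^2) (|s n|^2 - |s (n+1)|^2), and this
    telescopes, also in polarized form ([pairing_colligation]).
    With the state s n = sum_k a^k f (n+k), the sequence g is the adjoint of
    multiplication by the Blaschke factor B_a applied to f; with the state that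
    starts at s 0 = 0 and is driven by g, the sequence f is B_a * g. Hence
    multiplication by B_a is isometric, its adjoint is explicit, and
      f = (1 - |a|^2) k_a f(a) + B_a * g,
    where k_a is the kernel, with coefficients (conj a)^n
    ([blaschke_decomposition], [pairing_blaschke_adj]).

    Iterating over a_1, ..., a_N gives f = P_N f + r_N, where
    r_N = B_{a_1} * ... * B_{a_N} * g_N and |g_N| <= |f| ([mt_decomposition]), and
    |r_N|^2 = |g_N|^2 = <f, r_N>. When sum (1 - |a_n|) diverges, every
    coefficient of the product B_{a_1} * ... * B_{a_N} tends to zero
    ([blaschke_prod_coef_cvg0]), hence so does every coefficient of r_N. As r_N
    stays bounded, it tends weakly to zero, and |r_N|^2 = <f, r_N> turns this
    into convergence in norm ([mt_remainder_energy_cvg0]).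

    Uniform convergence on compact sets follows, because |r_N| bounds every
    coefficient of r_N, and therefore |r_N(z)| <= |r_N| / (1 - |z|). *)

(** * Quaternions *)

Section quaternions.
Context {R : realType}.
Local Notation H := (quat R).
Implicit Types p q : H.

Lemma sqr_normq q :
  `|q| ^+ 2 = qRe q ^+ 2 + qI q ^+ 2 + qJ q ^+ 2 + qK q ^+ 2.
Proof.
have -> : `|q| = qnorm q by [].
rewrite /qnorm; have -> : qRe (q * qconj q) =
  qRe q ^+ 2 + qI q ^+ 2 + qJ q ^+ 2 + qK q ^+ 2.
  by case: q => a b c d /=; ring.
by rewrite sqr_sqrtr // !addr_ge0 ?sqr_ge0.
Qed.

Lemma normqM p q : `|p * q| = `|p| * `|q|.
Proof.
apply: (@pexpIrn _ 2) => //; rewrite ?nnegrE ?mulr_ge0 ?normr_ge0 //.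
rewrite exprMn !sqr_normq; case: p q => ? ? ? ? [? ? ? ?] /=; ring.
Qed.

Lemma qunitE q : (q \is a GRing.unit) = (q != 0).
Proof. by []. Qed.

Lemma normq1 : `|1 : H| = 1.
Proof.
apply: (@pexpIrn _ 2) => //; rewrite ?nnegrE ?normr_ge0 ?ler01 //.
by rewrite sqr_normq /=; ring.
Qed.

Lemma normq_scalar (t : R) : `|t%:A : H| = `|t|.
Proof. by rewrite normrZ normq1 mulr1. Qed.

Lemma qscalarX (t : R) n : t%:A ^+ n = (t ^+ n)%:A :> H.
Proof. by rewrite exprZn expr1n. Qed.

Lemma normqX q n : `|q ^+ n| = `|q| ^+ n.
Proof. by elim: n => [|n IH]; rewrite ?expr0 ?normq1 // !exprS normqM IH. Qed.

Lemma norm_qconj q : `|qconj q| = `|q|.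
Proof.
apply: (@pexpIrn _ 2) => //; rewrite ?nnegrE ?normr_ge0 //.
by rewrite !sqr_normq /=; ring.
Qed.

Lemma qconj0 : qconj 0 = 0 :> H.
Proof. by congr Quat => /=; ring. Qed.

Lemma qconjN q : qconj (- q) = - qconj q.
Proof. by case: q => ? ? ? ?; congr Quat => /=; ring. Qed.

Lemma qconjK q : qconj (qconj q) = q.
Proof. by case: q => ? ? ? ?; congr Quat => /=; ring. Qed.

Lemma qconjZ (t : R) q : qconj (t *: q) = t *: qconj q.
Proof. by case: q => ? ? ? ?; congr Quat => /=; ring. Qed.

Lemma qconj1 : qconj 1 = 1 :> H.
Proof. by congr Quat => /=; ring. Qed.

Lemma qconjM p q : qconj (p * q) = qconj q * qconj p.
Proof. by case: p q => ? ? ? ? [? ? ? ?]; congr Quat => /=; ring. Qed.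

Lemma qconjX q n : qconj (q ^+ n) = qconj q ^+ n.
Proof. by elim: n => [|n IH]; rewrite ?expr0 ?qconj1 // exprSr qconjM IH exprS. Qed.

Lemma mul_qconj q : qconj q * q = (`|q| ^+ 2)%:A.
Proof.
by rewrite sqr_normq; case: q => a b c d; congr Quat => /=; ring.
Qed.

Lemma mulq_conj q : q * qconj q = (`|q| ^+ 2)%:A.
Proof. by rewrite -{1}(qconjK q) mul_qconj norm_qconj. Qed.

Lemma normr_coord_le q :
  [/\ `|qRe q| <= `|q|, `|qI q| <= `|q|, `|qJ q| <= `|q| & `|qK q| <= `|q|].
Proof.
have sq (x : R) : x ^+ 2 <= `|q| ^+ 2 -> `|x| <= `|q|.
  by rewrite -[x ^+ 2]real_normK ?num_real // ler_pXn2r ?nnegrE ?normr_ge0.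
have := sqr_ge0 (qRe q); have := sqr_ge0 (qI q).
have := sqr_ge0 (qJ q); have := sqr_ge0 (qK q) => ? ? ? ?.
by split; apply: sq; rewrite sqr_normq; lra.
Qed.

End quaternions.

(** * Real sequences *)

Section real_sequences.
Context {R : realType}.

Lemma cvg_sum0 (I : Type) (r : seq I) (F : I -> nat -> R) :
  (forall i, F i @ \oo --> 0) -> (fun n => \sum_(i <- r) F i n) @ \oo --> 0.
Proof.
move=> F0; elim: r => [|i r IH].
  have -> : (fun n => \sum_(i <- [::]) F i n) = (fun=> 0).
    by apply/funext => n; rewrite big_nil.
  exact: cvg_cst.
have -> : (fun n => \sum_(k <- i :: r) F k n) =
    (fun n => F i n + \sum_(k <- r) F k n).
  by apply/funext => n; rewrite big_cons.
rewrite -[X in _ --> X]addr0; apply: cvgD; [exact: F0|exact: IH].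
Qed.

Lemma energy_le_lim (V : normedZmodType R) (u : nat -> V) (L : R) n :
  series (fun k => `|u k| ^+ 2) @ \oo --> L ->
  series (fun k => `|u k| ^+ 2) n <= L.
Proof.
move=> uL; rewrite -(cvg_lim (@Rhausdorff R) uL).
apply: nondecreasing_cvgn_le; last exact: cvgP uL.
by apply/nondecreasing_seqP => i; rewrite seriesSr lerDl exprn_ge0.
Qed.

Lemma norm_le_energy (V : normedZmodType R) (u : nat -> V) (E : R) :
  (forall n, series (fun k => `|u k| ^+ 2) n <= E) -> forall n, `|u n| <= Num.sqrt E.
Proof.
move=> uE n; rewrite -[leLHS]ger0_norm // -sqrtr_sqr ler_wsqrtr //.
apply: le_trans (uE n.+1).
by rewrite seriesSr lerDr sumr_ge0 // => i _; rewrite exprn_ge0.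
Qed.

(** Once eps is below e / 2, the excess y of x over e / 2 satisfies
    y (n+1) <= al n * y n, so y is at most a constant over 1 + S, where S is
    the partial sum of the divergent series of 1 - al n. *)
Lemma contraction_cvg0 (al x eps : nat -> R) :
  (forall n, 0 <= al n <= 1) -> (forall n, 0 <= x n) ->
  (forall n, x n.+1 <= al n * x n + (1 - al n) * eps n) ->
  eps @ \oo --> 0 -> series (fun n => 1 - al n) @ \oo --> +oo ->
  x @ \oo --> 0.
Proof.
move=> al01 x0 xS eps0 div; apply/cvgr0Pnorm_le => /= e e0.
have e2 : 0 < e / 2 by rewrite divr_gt0.
move/cvgr0Pnorm_le/(_ _ e2) : eps0 => [N _ epsN].
pose S k : R := series (fun n => 1 - al n) (N + k)%N - series (fun n => 1 - al n) N.
have SS k : S k.+1 = S k + (1 - al (N + k)%N).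
  by rewrite /S addnS seriesSr addrAC.
have S0 k : 0 <= S k.
  elim: k => [|k IH]; first by rewrite /S addn0 subrr.
  by rewrite SS addr_ge0 // subr_ge0; case/andP: (al01 (N + k)%N).
have bound k : (x (N + k)%N - e / 2) * (1 + S k) <= x N.
  elim: k => [|k IH].
    by rewrite addn0 /S addn0 subrr addr0 mulr1 gerBl ltW.
  have /andP[a0 a1] := al01 (N + k)%N.
  have step : x (N + k.+1)%N - e / 2 <= al (N + k)%N * (x (N + k)%N - e / 2).
    have le_eps : eps (N + k)%N <= e / 2.
      by apply: le_trans (ler_norm _) _; apply: epsN; rewrite /= leq_addr.
    have := xS (N + k)%N; rewrite -addnS.
    have : (1 - al (N + k)%N) * eps (N + k)%N <= (1 - al (N + k)%N) * (e / 2).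
      by rewrite ler_wpM2l // subr_ge0.
    by lra.
  have S'0 : 0 <= 1 + S k.+1 by rewrite addr_ge0.
  have [y0|y0] := leP (x (N + k)%N - e / 2) 0.
    apply: le_trans (x0 N); rewrite mulr_le0_ge0 //.
    by apply: le_trans step _; rewrite mulr_ge0_le0.
  apply: le_trans IH; apply: le_trans (ler_wpM2r S'0 step) _.
  (* al * (1 + s + (1 - al)) <= 1 + s, as (1 - al)^2 and s * (1 - al) are >= 0. *)
  rewrite -mulrA mulrCA ler_wpM2l ?(ltW y0) // SS.
  move: (S0 k) a0 a1; set s := S k; set b := al _ => s0 b0 b1.
  have b1' : 0 <= 1 - b by rewrite subr_ge0.
  have := mulr_ge0 s0 b1'; have := sqr_ge0 (1 - b). lra.
move/cvgryPge/(_ (series (fun n => 1 - al n) N + 2 * x N / e)) : div => [M _ SM].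
exists (N + M)%N => // n /= Nn.
rewrite ger0_norm //.
have Mn : (M <= n)%N by lia.
have := bound (n - N)%N; rewrite subnKC; last by lia.
have := SM _ Mn; rewrite -lerBrDl => /=.
have -> : series (fun n => 1 - al n) n - series (fun n => 1 - al n) N =
  S (n - N)%N by rewrite /S subnKC //; lia.
move: (S0 (n - N)%N); set s := S _ => s0 sge bnd.
have xNe : x N <= e / 2 * s.
  by move: sge; rewrite ler_pdivrMr //; lra.
have s1 : 0 < 1 + s by lra.
have : (x n - e / 2) * (1 + s) <= e / 2 * (1 + s) by lra.
by rewrite ler_pM2r //; lra.
Qed.

Lemma cst_contraction_cvg0 (b : R) (x eps : nat -> R) :
  0 <= b < 1 -> (forall n, 0 <= x n) ->
  (forall n, x n.+1 <= b * x n + eps n) ->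
  eps @ \oo --> 0 -> x @ \oo --> 0.
Proof.
move=> /andP[b0 b1] x0 xS eps0.
have b1' : 0 < 1 - b by rewrite subr_gt0.
apply: (@contraction_cvg0 (fun=> b) x (fun n => (1 - b)^-1 * eps n)) => //.
- by move=> n; rewrite b0 ltW.
- by move=> n; rewrite mulrA divff ?mul1r ?gt_eqF.
- by rewrite -(mulr0 (1 - b)^-1); apply: cvgMr.
apply/cvgryPge => A; near=> n.
rewrite /series /= sumr_const_nat subn0 -[leRHS]mulr_natr mulrC -ler_pdivrMr //.
near: n; exact: nbhs_infty_ger.
Unshelve. all: by end_near. Qed.

End real_sequences.

(** * Quaternionic power series *)

Section power_series.
Context {R : realType}.
Local Notation H := (quat R).
(* A homonym, for real power series, is also in scope. *)
Local Notation pseries := (@Defs.pseries R).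

Lemma cvgqMl (c l : H) (u : nat -> H) :
  u @ \oo --> l -> (fun n => c * u n) @ \oo --> c * l.
Proof.
move=> ul; apply/subr_cvg0/norm_cvg0P.
have -> : (fun n => `|c * u n - c * l|) = (fun n => `|c| * `|u n - l|).
  by apply/funext => n; rewrite -mulrBr normqM.
rewrite -(mulr0 `|c|); apply: cvgMr.
by apply/norm_cvg0P/subr_cvg0.
Qed.

Lemma cvgqMr (c l : H) (u : nat -> H) :
  u @ \oo --> l -> (fun n => u n * c) @ \oo --> l * c.
Proof.
move=> ul; apply/subr_cvg0/norm_cvg0P.
have -> : (fun n => `|u n * c - l * c|) = (fun n => `|u n - l| * `|c|).
  by apply/funext => n; rewrite -mulrBl normqM.
rewrite -(mul0r `|c|); apply: cvgMl.
by apply/norm_cvg0P/subr_cvg0.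
Qed.

Lemma cvgq_unique {u : nat -> H} {l l' : H} :
  u @ \oo --> l -> u @ \oo --> l' -> l = l'.
Proof. by move=> ul ul'; exact: (norm_cvg_unique ul ul'). Qed.

Lemma norm_lim_le {V : normedModType R} (B : R) (u : nat -> V) (l : V) :
  (forall n, `|u n| <= B) -> u @ \oo --> l -> `|l| <= B.
Proof.
move=> uB /cvg_norm ul; apply: (cvgr_to_le ul).
by apply: nearW => n; exact: uB.
Qed.

Lemma cvg_quat_coord (u : nat -> H) :
  cvgn (fun n => qRe (u n)) -> cvgn (fun n => qI (u n)) ->
  cvgn (fun n => qJ (u n)) -> cvgn (fun n => qK (u n)) -> cvgn u.
Proof.
move=> /cvg_ex[a ua] /cvg_ex[b ub] /cvg_ex[c uc] /cvg_ex[d ud].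
have -> : u = (fun n => qRe (u n) *: (1 : H) + qI (u n) *: Quat 0 1 0 0
     + qJ (u n) *: Quat 0 0 1 0 + qK (u n) *: Quat 0 0 0 1).
  by apply/funext => n; case: (u n) => ? ? ? ?; congr Quat => /=; ring.
apply/cvg_ex; eexists.
by do 3?[apply: cvgD]; apply: cvgZr_tmp; [exact: ua|exact: ub|exact: uc|exact: ud].
Qed.

(** Completeness of the quaternions, inherited from the four real coordinates. *)
Lemma normed_cvgq (u : nat -> H) :
  cvgn (series (fun n => `|u n|)) -> cvgn (series u).
Proof.
move=> cu.
have coord (p : H -> R) : p 0 = 0 -> (forall x y, p (x + y) = p x + p y) ->
    (forall x, `|p x| <= `|x|) -> cvgn (fun n => p (series u n)).
  move=> p0 pD pB.
  have -> : (fun n => p (series u n)) = series (fun n => p (u n)).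
    apply/funext => n; rewrite /series /=.
    by elim/big_rec2 : _ => // i y z _ <-; rewrite pD.
  apply: normed_cvg; apply: (@series_le_cvg _ _ (fun n => `|u n|)) => //= n.
by apply: cvg_quat_coord; apply: coord => // x; case: (normr_coord_le x).
Qed.

Lemma bounded_geometric_series (C : R) (q : H) (w : nat -> H) n :
  (forall n, `|w n| <= C) -> `|q| < 1 ->
  series (fun n => `|q ^+ n * w n|) n <= C / (1 - `|q|).
Proof.
move=> wC q1.
have C0 : 0 <= C by apply: le_trans (wC 0%N).
have q1' : 0 < 1 - `|q| by rewrite subr_gt0.
apply: (@le_trans _ _ (series (geometric C `|q|) n)).
  by apply: ler_sum => k _; rewrite /= normqM normqX mulrC ler_wpM2r ?exprn_ge0.
rewrite geometric_seriesE ?lt_eqF //= ler_wpM2r ?invr_ge0 ?(ltW q1') //.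
by rewrite ler_piMr // gerBl exprn_ge0.
Qed.

Lemma cvg_bounded_pseries (C : R) (q : H) (w : nat -> H) :
  (forall n, `|w n| <= C) -> `|q| < 1 ->
  series (fun n => q ^+ n * w n) @ \oo --> pseries w q.
Proof.
move=> wC q1; apply: normed_cvgq.
apply: nondecreasing_is_cvgn.
  by apply/nondecreasing_seqP => n; rewrite seriesSr lerDl.
by exists (C / (1 - `|q|)) => _ [n _ <-]; exact: bounded_geometric_series.
Qed.

Lemma norm_pseries_le (C : R) (q : H) (w : nat -> H) :
  (forall n, `|w n| <= C) -> `|q| < 1 -> `|pseries w q| <= C / (1 - `|q|).
Proof.
move=> wC q1; apply: norm_lim_le (cvg_bounded_pseries _ _ _ wC q1) => n.
apply: le_trans (ler_norm_sum _ _ _) _.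
exact: bounded_geometric_series.
Qed.

Lemma pseries_bounded_expansion (C : R) (w : nat -> H) :
  (forall n, `|w n| <= C) -> has_expansion (pseries w) w.
Proof. by move=> wC q q1; exact: cvg_bounded_pseries wC q1. Qed.

Lemma expansion_pseries (f : H -> H) (w : nat -> H) (q : H) :
  has_expansion f w -> `|q| < 1 -> f q = pseries w q.
Proof. by move=> fw q1; apply/esym/cvg_lim; [exact: norm_hausdorff|exact: fw]. Qed.

(** The lowest coefficient that does not vanish, if there were one, would
    dominate the series at small real points. *)
Lemma expansion0_eq0 (c : nat -> H) : has_expansion (fun=> 0) c -> forall n, c n = 0.
Proof.
move=> c0.
have h1 : `|(2^-1)%:A : H| < 1.
  by rewrite normq_scalar ger0_norm ?invr_ge0 // invf_lt1 // ltr1n.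
have [M Mc] : exists M, forall n, `|c n| <= M * 2 ^+ n.
  have /cvg_series_cvg_0/cvgP/cvg_seq_bounded[M [_ Mb]] :
      cvgn (series (fun n => (2^-1)%:A ^+ n * c n)).
    by apply/cvg_ex; exists 0; apply: c0.
  exists (M + 1) => n.
  have := Mb (M + 1); rewrite ltrDl ltr01 => /(_ isT n I) /=.
  rewrite normqM normqX normq_scalar ger0_norm ?invr_ge0 // exprVn.
  by rewrite mulrC ler_pdivrMr // exprn_gt0.
have M0 : 0 <= M by have := Mc 0%N; rewrite expr0 mulr1; apply: le_trans.
elim/ltn_ind => m IH; pose C := M * 2 ^+ m.+1.
have C0 : 0 <= C by rewrite mulr_ge0 // exprn_ge0.
(* Dividing by t^m leaves c m + t * v; the partial sums v are bounded uniformly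
   in t, because 2 t <= 1/2 and (1/2)^k c (m+1+k) is bounded. *)
have small (t : R) : 0 < t <= 4^-1 -> `|c m| <= t * (2 * C).
  move=> /andP[t0 t4].
  have nt : `|t%:A : H| = t by rewrite normq_scalar gtr0_norm.
  pose v := series (fun k => t%:A ^+ k * c (m.+1 + k)%N).
  have vB N : `|v N| <= 2 * C.
    pose w k := (2^-1)%:A ^+ k * c (m.+1 + k)%N.
    have wC k : `|w k| <= C.
      rewrite /w normqM normqX normq_scalar ger0_norm ?invr_ge0 //.
      rewrite exprVn mulrC ler_pdivrMr ?exprn_gt0 //.
      by rewrite /C -mulrA -exprD.
    have q2 : `|(2 * t)%:A : H| = 2 * t.
      by rewrite normq_scalar gtr0_norm // mulr_gt0.
    have q1 : `|(2 * t)%:A : H| < 1 by rewrite q2; lra.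
    apply: le_trans (_ : C / (1 - `|(2 * t)%:A : H|) <= _); last first.
      by rewrite q2 ler_pdivrMr; nra.
    apply: le_trans (bounded_geometric_series _ _ _ N wC q1).
    apply: le_trans (ler_norm_sum _ _ _) _; apply: ler_sum => k _.
    rewrite le_eqVlt; apply/orP; left; apply/eqP; congr `|_|.
    rewrite /w mulrA; congr (_ * _).
    rewrite !qscalarX -scalerAl mul1r scalerA -exprMn.
    by congr ((_ ^+ _)%:A); lra.
  have part N : series (fun n => t%:A ^+ n * c n) (m.+1 + N)%N =
      t%:A ^+ m * (c m + t%:A * v N).
    elim: N => [|N IHN]; last first.
      rewrite addnS seriesSr IHN /v seriesSr !mulrDr -!addrA.
      by congr (_ + (_ + _)); rewrite !mulrA -exprSr -exprD.
    have -> : v 0%N = 0 by rewrite /v /series /= big_geq.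
    rewrite addn0 seriesSr mulr0 addr0 /series /=.
    rewrite big_nat big1 ?add0r // => i /andP[_ im].
    by rewrite IH // mulr0.
  have cv : (fun N => c m + t%:A * v N) @ \oo --> (0 : H).
    have -> : (fun N => c m + t%:A * v N) =
        (fun N => (t%:A ^+ m)^-1 * series (fun n => t%:A ^+ n * c n) (m.+1 + N)%N).
      apply/funext => N; rewrite part mulKr //.
      by rewrite unitrX // qunitE -normr_gt0 nt.
    rewrite -(mulr0 (t%:A ^+ m)^-1); apply: cvgqMl.
    apply: cvg_comp (cvg_addnl m.+1) _; apply: c0.
    by rewrite /qball /= nt; lra.
  have cm : (fun N => - (t%:A * v N)) @ \oo --> c m.
    rewrite -[c m]subr0.
    have -> : (fun N => - (t%:A * v N)) = (fun N => c m - (c m + t%:A * v N)).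
      by apply/funext => N; rewrite opprD addNKr.
    by apply: cvgB => //; exact: cvg_cst.
  apply: norm_lim_le cm => N.
  by rewrite normrN normqM nt ler_wpM2l // ltW.
apply: normr0_eq0; apply/eqP; rewrite eq_le normr_ge0 andbT.
apply/ler_addgt0Pr => e e0; rewrite add0r.
pose t := Num.min (4^-1 : R) (e / (2 * C + 1)).
have t0 : 0 < t by rewrite lt_min invr_gt0 ltr0n /= divr_gt0 //; lra.
apply: le_trans (small t _) _; first by rewrite t0 ge_min lexx.
apply: le_trans (_ : e / (2 * C + 1) * (2 * C) <= _).
  by rewrite ler_wpM2r ?ge_min ?lexx ?orbT //; lra.
by rewrite mulrAC ler_pdivrMr; nra.
Qed.

Lemma expansionMr (f : H -> H) (u : nat -> H) (c : H) :
  has_expansion f u -> has_expansion (fun z => f z * c) (fun n => u n * c).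
Proof.
move=> fu q q1.
have -> : series (fun n => q ^+ n * (u n * c)) =
    (fun N => series (fun n => q ^+ n * u n) N * c).
  apply/funext => N; rewrite /series /= mulr_suml.
  by apply: eq_bigr => k _; rewrite mulrA.
by apply: cvgqMr; exact: fu.
Qed.

Lemma expansionZ (f : H -> H) (u : nat -> H) (t : R) :
  has_expansion f u -> has_expansion (fun z => t *: f z) (fun n => t *: u n).
Proof.
have scale (x : H) : t *: x = x * t%:A by rewrite -scalerAr mulr1.
move=> fu; have -> : (fun z => t *: f z) = (fun z => f z * t%:A).
  by apply/funext.
have -> : (fun n => t *: u n) = (fun n => u n * t%:A) by apply/funext.
exact: expansionMr.
Qed.

Lemma expansionD (f g : H -> H) (u v : nat -> H) :
  has_expansion f u -> has_expansion g v ->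
  has_expansion (fun z => f z + g z) (fun n => u n + v n).
Proof.
move=> fu gv q q1.
have -> : series (fun n => q ^+ n * (u n + v n)) =
    (fun N => series (fun n => q ^+ n * u n) N + series (fun n => q ^+ n * v n) N).
  apply/funext => N; rewrite /series /= -big_split.
  by apply: eq_bigr => k _; rewrite mulrDr.
by apply: cvgD; [exact: fu|exact: gv].
Qed.

Lemma expansionB (f g : H -> H) (u v : nat -> H) :
  has_expansion f u -> has_expansion g v ->
  has_expansion (fun z => f z - g z) (fun n => u n - v n).
Proof.
move=> fu gv; have := expansionD _ _ _ _ fu (expansionZ _ _ (-1) gv).
by under [X in has_expansion X _]eq_fun do rewrite scaleN1r;
  under [X in has_expansion _ X]eq_fun do rewrite scaleN1r.
Qed.

Lemma expansion_sum (r : seq nat) (F : nat -> H -> H) (u : nat -> nat -> H) :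
  {in r, forall k, has_expansion (F k) (u k)} ->
  has_expansion (fun z => \sum_(k <- r) F k z) (fun n => \sum_(k <- r) u k n).
Proof.
elim: r => [|k r IH] Fu.
  move=> q q1; rewrite big_nil.
  have -> : series (fun n => q ^+ n * \sum_(k <- [::]) u k n) = fun=> 0.
    by apply/funext => n; rewrite /series /= big1 // => i _; rewrite big_nil mulr0.
  exact: cvg_cst.
have -> : (fun z => \sum_(j <- k :: r) F j z) = (fun z => F k z + \sum_(j <- r) F j z).
  by apply/funext => z; rewrite big_cons.
have -> : (fun n => \sum_(j <- k :: r) u j n) = (fun n => u k n + \sum_(j <- r) u j n).
  by apply/funext => z; rewrite big_cons.
apply: expansionD; first by apply: Fu; rewrite mem_head.
by apply: IH => j jr; apply: Fu; rewrite in_cons jr orbT.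
Qed.

Lemma expansion_inj (f : H -> H) (u v : nat -> H) :
  has_expansion f u -> has_expansion f v -> u = v.
Proof.
move=> fu fv; apply/funext => n; apply/subr0_eq.
apply: (expansion0_eq0 (fun n => u n - v n)).
by have := expansionB _ _ _ _ fu fv; under eq_fun do rewrite subrr.
Qed.

Lemma coef_expansion (f : H -> H) (u : nat -> H) : has_expansion f u -> coef f = u.
Proof.
move=> fu; apply: (expansion_inj f) => //.
by rewrite /coef; apply: (xgetPex (fun=> 0)); exists u.
Qed.

End power_series.

(** * Cauchy products *)

Section cauchy_product.
Context {S : nzRingType}.
Implicit Types u v w : nat -> S.

Definition cprod u v n : S := \sum_(k < n.+1) u k * v (n - k)%N.

Definition cprod_unit n : S := (n == 0%N)%:R.

Lemma cprod_poly N u v n : (n < N)%N ->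
  cprod u v n = ((\poly_(i < N) u i) * (\poly_(i < N) v i))`_n.
Proof.
move=> nN; rewrite coefM; apply: eq_bigr => k _.
rewrite !coef_poly (leq_ltn_trans (leq_subr _ _) nN).
by rewrite (leq_ltn_trans _ nN) // -ltnS.
Qed.

(** Coefficients up to n are those of a product of truncations, so
    associativity is inherited from polynomials. *)
Lemma cprodA u v w : cprod u (cprod v w) = cprod (cprod u v) w.
Proof.
apply/funext => n.
transitivity ((\poly_(i < n.+1) u i * (\poly_(i < n.+1) v i * \poly_(i < n.+1) w i))`_n).
  rewrite coefM; apply: eq_bigr => k _; rewrite coef_poly ltn_ord.
  by rewrite (cprod_poly n.+1) // ltnS leq_subr.
rewrite mulrA coefM; apply: eq_bigr => k _.
by rewrite (cprod_poly n.+1) // coef_poly ltnS leq_subr.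
Qed.

Lemma cprod1u u : cprod cprod_unit u = u.
Proof.
apply/funext => n; rewrite /cprod big_ord_recl big1 /= => [|k _].
  by rewrite /cprod_unit /= mul1r subn0 addr0.
by rewrite /cprod_unit /= mul0r.
Qed.

Lemma cprodDr u v w : cprod u (fun n => v n + w n) = fun n => cprod u v n + cprod u w n.
Proof.
apply/funext => n; rewrite /cprod -big_split; apply: eq_bigr => k _.
by rewrite mulrDr.
Qed.

Lemma cprodMr u v c : cprod u (fun n => v n * c) = fun n => cprod u v n * c.
Proof.
apply/funext => n; rewrite /cprod mulr_suml; apply: eq_bigr => k _.
by rewrite mulrA.
Qed.

Lemma cprod0 u v : cprod u v 0%N = u 0%N * v 0%N.
Proof. by rewrite /cprod big_ord_recl big_ord0 addr0. Qed.

End cauchy_product.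

(** * One Blaschke factor *)

Section blaschke_factor.
Context {R : realType}.
Local Notation H := (quat R).
Local Notation pseries := (@Defs.pseries R).
Implicit Types (a : H) (f u s : nat -> H).

(** The coefficients of the kernel (1 - q conj a)^{-*}, see [szego_expansion]. *)
Definition szego_coef a n : H := qconj a ^+ n.

(** The product of the kernel with q - a, see [blaschke_coefE]. *)
Definition blaschke_coef a n : H :=
  if n is k.+1 then (1 - `|a| ^+ 2) *: szego_coef a k else - a.

Lemma pairing_step a (s t s' t' : H) :
  qconj (s' - a * t') * (s - a * t) =
  qconj (t' - qconj a * s') * (t - qconj a * s) +
  (1 - `|a| ^+ 2) *: (qconj s' * s - qconj t' * t).
Proof.
rewrite sqr_normq; case: a s t s' t' => ? ? ? ? [? ? ? ?] [? ? ? ?] [? ? ? ?] [? ? ? ?].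
by congr Quat => /=; ring.
Qed.

(** Both outputs are read off the same state, and the difference of their
    pairings at index n is a discrete derivative of the pairing of the states. *)
Lemma pairing_colligation a s s' N :
  series (fun n => qconj (s' n - a * s' n.+1) * (s n - a * s n.+1)) N =
  series (fun n => qconj (s' n.+1 - qconj a * s' n) * (s n.+1 - qconj a * s n)) N +
  (1 - `|a| ^+ 2) *: (qconj (s' 0%N) * s 0%N - qconj (s' N) * s N).
Proof.
elim: N => [|N IH]; first by rewrite /series /= !big_geq // subrr scaler0 addr0.
rewrite !seriesSr IH pairing_step -!addrA; congr (_ + _).
rewrite addrCA; congr (_ + _); rewrite -scalerDr; congr (_ *: _).
by rewrite addrA subrK.
Qed.

Lemma energy_colligation a s N :
  series (fun n => `|s n - a * s n.+1| ^+ 2) N =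
  series (fun n => `|s n.+1 - qconj a * s n| ^+ 2) N +
  (1 - `|a| ^+ 2) * (`|s 0%N| ^+ 2 - `|s N| ^+ 2).
Proof.
have toRe (v : nat -> H) M : series (fun n => `|v n| ^+ 2) M =
    qRe (series (fun n => qconj (v n) * v n) M).
  elim: M => [|M IH]; first by rewrite /series /= !big_geq.
  by rewrite !seriesSr IH mul_qconj /= mulr1.
rewrite !toRe pairing_colligation !mul_qconj.
by rewrite -scalerBl scalerA /= mulr1.
Qed.

(** The state of the linear system that turns the input u into its product with
    the Blaschke factor ([cprod_blaschke_state]); as a sequence of coefficients it
    is that of q times the product of the kernel with u. *)
Fixpoint bstate a u n : H :=
  if n is k.+1 then u k + qconj a * bstate a u k else 0.

Lemma bstateE a u n : bstate a u n = \sum_(k < n) szego_coef a k * u (n.-1 - k)%N.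
Proof.
elim: n => [|n IH]; first by rewrite big_ord0.
rewrite big_ord_recl /= subn0 /szego_coef expr0 mul1r IH; congr (_ + _).
rewrite mulr_sumr; apply: eq_bigr => k _; rewrite mulrA -exprS.
by rewrite /bump /= add1n; congr (_ * u _); have := ltn_ord k; lia.
Qed.

Lemma cprod_blaschke a u n :
  cprod (blaschke_coef a) u n = (1 - `|a| ^+ 2) *: bstate a u n - a * u n.
Proof.
rewrite /cprod big_ord_recl /= subn0 mulNr addrC bstateE scaler_sumr.
congr (_ - _); apply: eq_bigr => k _; rewrite /= -scalerAl; congr (_ *: (_ * u _)).
by rewrite /bump /=; have := ltn_ord k; lia.
Qed.

Lemma cprod_blaschke_state a u n :
  cprod (blaschke_coef a) u n = bstate a u n - a * bstate a u n.+1.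
Proof.
rewrite cprod_blaschke /= mulrDr mulrA mulq_conj -scalerAl mul1r scalerBl scale1r.
by rewrite opprD addrAC addrA.
Qed.

Lemma bstate_cvg0 a u : `|a| < 1 -> u @ \oo --> 0 -> bstate a u @ \oo --> 0.
Proof.
move=> a1 u0; apply/norm_cvg0P.
apply: (@cst_contraction_cvg0 _ `|a| _ (fun n => `|u n|)).
- by rewrite normr_ge0.
- by move=> n; exact: normr_ge0.
- move=> n /=; rewrite addrC; apply: le_trans (ler_normD _ _) _.
  by rewrite normqM norm_qconj addrC.
- exact/norm_cvg0P.
Qed.

Lemma cprod_blaschke_cvg0 a u : `|a| < 1 -> u @ \oo --> 0 ->
  cprod (blaschke_coef a) u @ \oo --> 0.
Proof.
move=> a1 u0; have b0 := bstate_cvg0 a u a1 u0.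
have -> : cprod (blaschke_coef a) u = (fun n => bstate a u n - a * bstate a u n.+1).
  by apply/funext => n; rewrite cprod_blaschke_state.
have -> : 0 = 0 - a * 0 :> H by rewrite mulr0 subr0.
apply: cvgB => //; apply: cvgqMl.
by rewrite (cvg_shiftS (bstate a u)).
Qed.

Lemma bstate_bounded a u (C : R) : `|a| < 1 -> (forall n, `|u n| <= C) ->
  forall n, `|bstate a u n| <= C / (1 - `|a|).
Proof.
move=> a1 uC; have a1' : 0 < 1 - `|a| by rewrite subr_gt0.
have C0 : 0 <= C by apply: le_trans (uC 0%N).
elim=> [|n IH] /=; first by rewrite normr0 divr_ge0 // ltW.
apply: le_trans (ler_normD _ _) _; rewrite normqM norm_qconj.
apply: le_trans (lerD (uC n) (ler_wpM2l (normr_ge0 a) IH)) _.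
rewrite le_eqVlt; apply/orP; left; apply/eqP; field.
by rewrite gt_eqF.
Qed.

(** The state starts at zero, so the energy balance leaves only the energy still
    stored in the state at index N, with a negative sign. *)
Lemma norm_cprod_blaschke_energy a u N :
  `|a| < 1 -> series (fun n => `|cprod (blaschke_coef a) u n| ^+ 2) N <=
  series (fun n => `|u n| ^+ 2) N.
Proof.
move=> a1.
have -> : (fun n => `|cprod (blaschke_coef a) u n| ^+ 2) =
    (fun n => `|bstate a u n - a * bstate a u n.+1| ^+ 2).
  by apply/funext => n; rewrite cprod_blaschke_state.
rewrite energy_colligation /= normr0 expr0n /= sub0r.
have -> : (fun n => `|u n + qconj a * bstate a u n - qconj a * bstate a u n| ^+ 2) =
    (fun n => `|u n| ^+ 2) by apply/funext => n; rewrite addrK.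
rewrite gerDl mulrN oppr_le0 mulr_ge0 ?exprn_ge0 // subr_ge0.
by rewrite exprn_ile1 // ltW.
Qed.

Lemma cprod_blaschke_bounded a u (C : R) : `|a| < 1 -> (forall n, `|u n| <= C) ->
  exists D, forall n, `|cprod (blaschke_coef a) u n| <= D.
Proof.
move=> a1 uC; have bB := bstate_bounded a u C a1 uC.
exists (C / (1 - `|a|) + `|a| * (C / (1 - `|a|))) => n.
rewrite cprod_blaschke_state; apply: le_trans (ler_normB _ _) _.
by rewrite normqM lerD // ler_wpM2l.
Qed.

(** The value at a, in the sense of coefficients on the right, of f shifted n
    times backward. In particular [tail_eval a f 0] is the pairing of f with the
    kernel at a. *)
Definition tail_eval a f n : H := pseries (fun k => f (n + k)%N) a.

(** The coefficient sequence of the adjoint of multiplication by the Blaschke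
    factor, applied to [f]. *)
Definition blaschke_adj a f n : H :=
  tail_eval a f n.+1 - qconj a * tail_eval a f n.

Section tail.
Variables (a : H) (f : nat -> H) (C : R).
Hypotheses (a1 : `|a| < 1) (fC : forall n, `|f n| <= C).

Lemma tail_evalE n : f n = tail_eval a f n - a * tail_eval a f n.+1.
Proof using a1 fC.
have cvt m : series (fun k => a ^+ k * f (m + k)%N) @ \oo --> tail_eval a f m.
  by apply: (cvg_bounded_pseries C).
have := cvt n; rewrite -cvg_shiftS => lim1.
have lim2 : (fun N => f n + a * series (fun k => a ^+ k * f (n.+1 + k)%N) N)
    @ \oo --> f n + a * tail_eval a f n.+1.
  by apply: cvgD; [exact: cvg_cst|exact: cvgqMl].
have eqs : (fun N => series (fun k => a ^+ k * f (n + k)%N) N.+1) =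
    (fun N => f n + a * series (fun k => a ^+ k * f (n.+1 + k)%N) N).
  apply/funext => N; rewrite /series /= big_nat_recl // addn0 expr0 mul1r.
  congr (_ + _); rewrite mulr_sumr; apply: eq_bigr => k _.
  by rewrite exprS mulrA addnS addSn.
rewrite /= eqs in lim1.
by rewrite (cvgq_unique lim1 lim2) addrK.
Qed.

Lemma tail_eval_cvg0 : f @ \oo --> 0 -> tail_eval a f @ \oo --> 0.
Proof using a1 fC.
have a1' : 0 < 1 - `|a| by rewrite subr_gt0.
move=> /cvgr0Pnorm_le f0; apply/cvgr0Pnorm_le => /= e e0.
have [N _ fN] := f0 (e * (1 - `|a|)) (mulr_gt0 e0 a1').
exists N => // n /= Nn; rewrite -[leRHS](mulfK (lt0r_neq0 a1')).
apply: norm_pseries_le a1 => k; apply: fN => /=; exact: leq_trans (leq_addr _ _).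
Qed.

Lemma blaschke_adj_cvg0 : f @ \oo --> 0 -> blaschke_adj a f @ \oo --> 0.
Proof using a1 fC.
move=> /tail_eval_cvg0 t0; have -> : 0 = 0 - qconj a * 0 :> H.
  by rewrite mulr0 subr0.
apply: cvgB; last exact: cvgqMl.
by rewrite (cvg_shiftS (tail_eval a f)).
Qed.

(** A sequence is its projection on the Szego kernel plus a multiple of the
    Blaschke factor. *)
Lemma blaschke_decomposition :
  f = fun n => szego_coef a n * ((1 - `|a| ^+ 2) *: tail_eval a f 0)
        + cprod (blaschke_coef a) (blaschke_adj a f) n.
Proof using a1 fC.
set s := tail_eval a f.
have state n : bstate a (blaschke_adj a f) n = s n - szego_coef a n * s 0%N.
  elim: n => [|n IH] /=; first by rewrite /szego_coef expr0 mul1r subrr.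
  rewrite IH /blaschke_adj -/s mulrBr addrA subrK.
  by rewrite mulrA /szego_coef -exprS.
apply/funext => n.
rewrite cprod_blaschke_state !state [f n]tail_evalE -/s.
rewrite /szego_coef [qconj a ^+ n.+1]exprS sqr_normq.
move: (qconj a ^+ n) (s n) (s n.+1) (s 0%N).
case: a => ? ? ? ? [? ? ? ?] [? ? ? ?] [? ? ? ?] [? ? ? ?].
by congr Quat => /=; ring.
Qed.

(** Adjointness: the state of the product starts at 0 and both states vanish at
    infinity, so the boundary terms of [pairing_colligation] disappear. *)
Lemma pairing_blaschke_adj u (l : H) :
  f @ \oo --> 0 -> u @ \oo --> 0 ->
  series (fun n => qconj (u n) * blaschke_adj a f n) @ \oo --> l ->
  series (fun n => qconj (cprod (blaschke_coef a) u n) * f n) @ \oo --> l.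
Proof using a1 fC.
move=> f0 u0 ul.
have -> : series (fun n => qconj (cprod (blaschke_coef a) u n) * f n) =
  (fun N => series (fun n => qconj (u n) * blaschke_adj a f n) N -
     (1 - `|a| ^+ 2) *: (qconj (bstate a u N) * tail_eval a f N)).
  apply/funext => N.
  have -> : (fun n => qconj (cprod (blaschke_coef a) u n) * f n) =
     (fun n => qconj (bstate a u n - a * bstate a u n.+1) *
                (tail_eval a f n - a * tail_eval a f n.+1)).
    by apply/funext => n; rewrite cprod_blaschke_state -tail_evalE.
  rewrite pairing_colligation /= qconj0 mul0r sub0r scalerN; congr (_ - _).
  by congr (series _ N); apply/funext => n; rewrite addrK.
rewrite -[l]subr0; apply: cvgB => //.
have B0 := bstate_cvg0 a u a1 u0; have T0 := tail_eval_cvg0 f0.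
apply/norm_cvg0P.
have -> : (fun N => `|(1 - `|a| ^+ 2) *: (qconj (bstate a u N) * tail_eval a f N)|)
  = (fun N => `|1 - `|a| ^+ 2| * (`|bstate a u N| * `|tail_eval a f N|)).
  by apply/funext => N; rewrite normrZ normqM norm_qconj.
have -> : 0 = `|1 - `|a| ^+ 2| * (0 * 0) :> R by rewrite !mulr0.
by apply: cvgMr; apply: cvgM; apply/norm_cvg0P.
Qed.

(** The energy lost is exactly that of the projection on the kernel at a. *)
Lemma energy_blaschke_adj (l : R) :
  f @ \oo --> 0 -> series (fun n => `|f n| ^+ 2) @ \oo --> l ->
  series (fun n => `|blaschke_adj a f n| ^+ 2) @ \oo -->
    l - (1 - `|a| ^+ 2) * `|tail_eval a f 0| ^+ 2.
Proof using a1 fC.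
move=> f0 fl.
have -> : series (fun n => `|blaschke_adj a f n| ^+ 2) = (fun N =>
  series (fun n => `|f n| ^+ 2) N -
   (1 - `|a| ^+ 2) * (`|tail_eval a f 0| ^+ 2 - `|tail_eval a f N| ^+ 2)).
  apply/funext => N.
  have -> : (fun n => `|f n| ^+ 2) =
      (fun n => `|tail_eval a f n - a * tail_eval a f n.+1| ^+ 2).
    by apply/funext => n; rewrite -tail_evalE.
  by rewrite energy_colligation addrK.
apply: cvgB => //; apply: cvgMr.
rewrite -[X in _ --> X]subr0; apply: cvgB; first exact: cvg_cst.
have /norm_cvg0P T0 := tail_eval_cvg0 f0.
by rewrite -[0](mulr0 0); under eq_fun do rewrite expr2; apply: cvgM.
Qed.

End tail.

End blaschke_factor.

(** * Finite Blaschke products *)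

Section blaschke_products.
Context {R : realType}.
Local Notation H := (quat R).
Implicit Types (a : H) (f u : nat -> H) (l : seq H).

Lemma cvg0_bounded f : f @ \oo --> 0 -> exists C, forall n, `|f n| <= C.
Proof.
move=> /cvgP/cvg_seq_bounded[M [_ Mb]]; exists (M + 1) => n.
by apply: Mb => //; rewrite ltrDl.
Qed.

Lemma szego_coef_cvg0 a : `|a| < 1 -> szego_coef a @ \oo --> 0.
Proof.
move=> a1; apply/norm_cvg0P.
have -> : (fun n => `|szego_coef a n|) = (fun n => `|a| ^+ n).
  by apply/funext => n; rewrite normqX norm_qconj.
by apply: cvg_expr; rewrite normr_id.
Qed.

Definition blaschke_prod l : nat -> H :=
  foldl cprod cprod_unit [seq blaschke_coef a | a <- l].

Definition blaschke_prod_adj l f : nat -> H :=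
  foldl (fun g a => blaschke_adj a g) f l.

(** The accumulator of a left-nested product splits off as a left factor, so
    that the first Blaschke factor can be peeled off in inductions on l. *)
Lemma foldl_cprod_blaschke b l :
  foldl cprod b [seq blaschke_coef a | a <- l] = cprod b (blaschke_prod l).
Proof.
rewrite /blaschke_prod; elim: l b => [|a l IH] b /=.
  apply/funext => n; rewrite /cprod big_ord_recr big1 /= => [|k _].
    by rewrite subnn /cprod_unit mulr1 add0r.
  by rewrite /cprod_unit -(inj_eq (@addnI k)) subnKC ?(ltnW (ltn_ord k)) // addn0
    gtn_eqF // mulr0.
by rewrite IH cprod1u [in RHS]IH cprodA.
Qed.

Lemma blaschke_prod_cons a l :
  blaschke_prod (a :: l) = cprod (blaschke_coef a) (blaschke_prod l).
Proof. by rewrite /blaschke_prod /= cprod1u foldl_cprod_blaschke. Qed.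

Lemma blaschke_prod_rcons a l :
  blaschke_prod (rcons l a) = cprod (blaschke_prod l) (blaschke_coef a).
Proof. by rewrite /blaschke_prod map_rcons foldl_rcons. Qed.

Lemma blaschke_prod_adj_rcons a l f :
  blaschke_prod_adj (rcons l a) f = blaschke_adj a (blaschke_prod_adj l f).
Proof. by rewrite /blaschke_prod_adj foldl_rcons. Qed.

Lemma cprod_blaschke_prod_cvg0 l u : all (fun a => `|a| < 1) l ->
  u @ \oo --> 0 -> cprod (blaschke_prod l) u @ \oo --> 0.
Proof.
move=> + u0; elim: l => [|a l IH] /=; first by rewrite cprod1u.
move=> /andP[a1 /IH l0]; rewrite blaschke_prod_cons -cprodA.
exact: cprod_blaschke_cvg0.
Qed.

Section fixed_points.
Variable l : seq H.
Hypothesis l1 : all (fun a => `|a| < 1) l.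

Lemma blaschke_prod_energy_le u N :
  series (fun n => `|cprod (blaschke_prod l) u n| ^+ 2) N <=
  series (fun n => `|u n| ^+ 2) N.
Proof using l1.
elim: l l1 => [|a s IH] /=; first by rewrite cprod1u.
move=> /andP[a1 /IH sN]; rewrite blaschke_prod_cons -cprodA.
exact: le_trans (norm_cprod_blaschke_energy _ _ _ a1) sN.
Qed.

Lemma blaschke_prod_adj_cvg0 f :
  f @ \oo --> 0 -> blaschke_prod_adj l f @ \oo --> 0.
Proof using l1.
elim: l l1 f => [|a s IH] //= /andP[a1 s1] f f0.
have [C fC] := cvg0_bounded _ f0.
by apply: IH => //; exact: blaschke_adj_cvg0 fC f0.
Qed.

(** Adjoints compose in the opposite order: the factor nearest to the left is
    moved to f first. *)
Lemma pairing_blaschke_prod f u (z : H) :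
  f @ \oo --> 0 -> u @ \oo --> 0 ->
  series (fun n => qconj (u n) * blaschke_prod_adj l f n) @ \oo --> z ->
  series (fun n => qconj (cprod (blaschke_prod l) u n) * f n) @ \oo --> z.
Proof using l1.
move=> + u0; elim: l l1 f => [|a s IH] /=; first by rewrite cprod1u.
move=> /andP[a1 s1] f f0 uz; have [C fC] := cvg0_bounded _ f0.
rewrite blaschke_prod_cons -cprodA.
apply: (pairing_blaschke_adj a f C) => //.
  exact: cprod_blaschke_prod_cvg0.
by apply: IH => //; exact: blaschke_adj_cvg0 fC f0.
Qed.

Lemma blaschke_prod_adj_energy f (L : R) :
  f @ \oo --> 0 -> series (fun n => `|f n| ^+ 2) @ \oo --> L ->
  exists2 L', L' <= L &
    series (fun n => `|blaschke_prod_adj l f n| ^+ 2) @ \oo --> L'.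
Proof using l1.
elim: l l1 f L => [|a s IH] /=; first by move=> _ f L f0 fL; exists L.
move=> /andP[a1 s1] f L f0 fL; have [C fC] := cvg0_bounded _ f0.
have [|L' L'le L'cv] := IH s1 _ _ _ (energy_blaschke_adj a f C a1 fC L f0 fL).
  exact: blaschke_adj_cvg0 fC f0.
exists L' => //; apply: le_trans L'le _.
rewrite gerBl mulr_ge0 ?exprn_ge0 // subr_ge0.
by rewrite exprn_ile1 // ltW.
Qed.

End fixed_points.

End blaschke_products.

(** * The Malmquist-Takenaka system *)

Section malmquist_takenaka_sequences.
Context {R : realType}.
Local Notation H := (quat R).
Variable a : nat -> H.
Hypothesis ha : forall n, (1 <= n)%N -> `|a n| < 1.
Implicit Types f : nat -> H.

Definition points n : seq H := [seq a k | k <- index_iota 1 n.+1].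

Lemma pointsS n : points n.+1 = rcons (points n) (a n.+1).
Proof.
rewrite /points /index_iota !subSS !subn0 -[n.+1 in LHS]addn1.
by rewrite iotaD map_cat cats1 add1n.
Qed.

Lemma points_ball n : all (fun x => `|x| < 1) (points n).
Proof using ha.
by apply/allP => _ /mapP[k + ->]; rewrite mem_index_iota => /andP[k1 _]; exact: ha.
Qed.

Definition mt_coef k n : H :=
  Num.sqrt (1 - `|a k| ^+ 2) *:
    cprod (blaschke_prod (points k.-1)) (szego_coef (a k)) n.

(** The Fourier coefficients, computed by moving the Blaschke product of
    [mt_coef] to f and evaluating at the remaining point, see [mt_fourierE]. *)
Definition mt_fourier f k : H :=
  Num.sqrt (1 - `|a k| ^+ 2) *:
    tail_eval (a k) (blaschke_prod_adj (points k.-1) f) 0.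

Definition mt_remainder f N : nat -> H :=
  cprod (blaschke_prod (points N)) (blaschke_prod_adj (points N) f).

(** Move the Blaschke product to f; what is left is the pairing with the kernel
    at a k, which is evaluation at a k. *)
Lemma mt_fourierE f k : (1 <= k)%N -> f @ \oo --> 0 ->
  series (fun n => qconj (mt_coef k n) * f n) @ \oo --> mt_fourier f k.
Proof using ha.
move=> k1 f0; have ak1 := ha _ k1.
have -> : series (fun n => qconj (mt_coef k n) * f n) = (fun N =>
    Num.sqrt (1 - `|a k| ^+ 2) *: series (fun n =>
    qconj (cprod (blaschke_prod (points k.-1)) (szego_coef (a k)) n) * f n) N).
  apply/funext => N; rewrite /series /= scaler_sumr; apply: eq_bigr => n _.
  by rewrite qconjZ scalerAl.
apply: cvgZl_tmp; apply: pairing_blaschke_prod => //.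
- exact: points_ball.
- exact: szego_coef_cvg0.
have g0 := blaschke_prod_adj_cvg0 _ (points_ball k.-1) _ f0.
have [C gC] := cvg0_bounded _ g0.
have -> : (fun n => qconj (szego_coef (a k) n) * blaschke_prod_adj (points k.-1) f n)
    = (fun n => a k ^+ n * blaschke_prod_adj (points k.-1) f (0 + n)%N).
  by apply/funext => n; rewrite qconjX qconjK.
by apply: (cvg_bounded_pseries C).
Qed.

(** At each step [blaschke_decomposition] is applied to the last factor of the
    remainder; the two roots of 1 - |a k|^2 combine. *)
Lemma mt_decomposition f N : f @ \oo --> 0 ->
  f = fun n => \sum_(1 <= k < N.+1) mt_coef k n * mt_fourier f k
                 + mt_remainder f N n.
Proof using ha.
move=> f0; elim: N => [|N IH]; apply/funext => n.
  by rewrite big_geq // add0r /mt_remainder /= /points /= cprod1u.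
rewrite [RHS](_ : _ = \sum_(1 <= k < N.+1) mt_coef k n * mt_fourier f k +
  (mt_coef N.+1 n * mt_fourier f N.+1 + mt_remainder f N.+1 n)); last first.
  by rewrite big_nat_recr //= addrA.
rewrite [LHS](congr1 (@^~ n) IH); congr (_ + _).
have ak1 := ha _ (ltn0Sn N).
have g0 := blaschke_prod_adj_cvg0 _ (points_ball N) _ f0.
have [C gC] := cvg0_bounded _ g0.
have root2 : Num.sqrt (1 - `|a N.+1| ^+ 2) ^+ 2 = 1 - `|a N.+1| ^+ 2.
  by apply: sqr_sqrtr; rewrite subr_ge0 exprn_ile1 // ltW.
rewrite /mt_remainder pointsS blaschke_prod_rcons blaschke_prod_adj_rcons -cprodA.
rewrite {1}(blaschke_decomposition _ _ _ ak1 gC) cprodDr cprodMr; congr (_ + _).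
rewrite /mt_coef /mt_fourier /= -scalerAl -!scalerAr scalerA -expr2 root2 //.
Qed.

Hypothesis div : series (fun n => 1 - `|a n.+1|) @ \oo --> +oo.

(** Passing from n to n+1 factors multiplies the coefficient of index j by a
    number of modulus |a (n+1)|, up to lower coefficients weighted by
    1 - |a (n+1)|^2; divergence of the sum of 1 - |a n| then forces decay. *)
Lemma blaschke_prod_coef_cvg0 j :
  (fun N => `|blaschke_prod (points N) j|) @ \oo --> 0.
Proof using ha div.
elim/ltn_ind: j => j IH.
apply: (@contraction_cvg0 _ (fun n => `|a n.+1|) _
  (fun N => 2 * \sum_(i < j) `|blaschke_prod (points N) i|)) => //.
- by move=> n; rewrite normr_ge0 ltW //; exact: ha.
- move=> n; have an1 := ha _ (ltn0Sn n).
  have an1' : 0 <= 1 - `|a n.+1| by rewrite subr_ge0 ltW.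
  rewrite pointsS blaschke_prod_rcons /cprod big_ord_recr /= subnn /=.
  apply: le_trans (ler_normD _ _) _; rewrite addrC normqM normrN mulrC lerD2l.
  apply: le_trans (ler_norm_sum _ _ _) _.
  rewrite mulrA mulr_sumr; apply: ler_sum => i _.
  rewrite normqM mulrC ler_wpM2r //.
  have -> : (j - i)%N = (j - i).-1.+1 by rewrite prednK // subn_gt0.
  rewrite /= normrZ normqX norm_qconj ger0_norm; last first.
    by rewrite subr_ge0 exprn_ile1 // ltW.
  have p1 : `|a n.+1| ^+ (j - i).-1 <= 1 by rewrite exprn_ile1 // ltW.
  have q0 : 0 <= 1 - `|a n.+1| ^+ 2 by rewrite subr_ge0 exprn_ile1 // ltW.
  have step := ler_wpM2l q0 p1; apply: (le_trans step).
  by have := normr_ge0 (a n.+1); nra.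
rewrite -[X in _ --> X](mulr0 2); apply: cvgMr.
apply: cvg_sum0 => i; exact: IH.
Qed.

(** A coefficient of the remainder involves finitely many coefficients of the
    Blaschke product, each multiplied by a number bounded by the norm of f. *)
Lemma mt_remainder_coef_cvg0 f (L : R) j :
  f @ \oo --> 0 -> series (fun n => `|f n| ^+ 2) @ \oo --> L ->
  (fun N => `|mt_remainder f N j|) @ \oo --> 0.
Proof using ha div.
move=> f0 fL.
have gB N m : `|blaschke_prod_adj (points N) f m| <= Num.sqrt L.
  have [L' L'L gL'] := blaschke_prod_adj_energy _ (points_ball N) _ _ f0 fL.
  apply: norm_le_energy => n; apply: le_trans L'L; exact: energy_le_lim gL'.
apply: (@squeeze_cvgr _ _ _ _ (fun=> 0) (fun N =>
  (\sum_(i < j.+1) `|blaschke_prod (points N) i|) * Num.sqrt L)).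
- apply: nearW => N; rewrite normr_ge0 /= /mt_remainder /cprod mulr_suml.
  apply: le_trans (ler_norm_sum _ _ _) _; apply: ler_sum => i _.
  by rewrite normqM ler_wpM2l.
- exact: cvg_cst.
rewrite -[X in _ --> X](mul0r (Num.sqrt L)); apply: cvgMl.
by apply: cvg_sum0 => i; exact: blaschke_prod_coef_cvg0.
Qed.

(** The bound l N is the energy of [blaschke_prod_adj (points N) f], which equals
    the pairing of the remainder with f. That pairing tends to zero: the remainder
    is bounded and tends to zero coefficientwise, and the tails of f are small. *)
Lemma mt_remainder_energy_cvg0 f (L : R) :
  f @ \oo --> 0 -> series (fun n => `|f n| ^+ 2) @ \oo --> L ->
  exists2 l : nat -> R, l @ \oo --> 0 &
    forall N n, series (fun n => `|mt_remainder f N n| ^+ 2) n <= l N.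
Proof using ha div.
move=> f0 fL.
pose g N := blaschke_prod_adj (points N) f.
have g0 N : g N @ \oo --> 0.
  by apply: blaschke_prod_adj_cvg0 => //; exact: points_ball.
have [l gl] : exists l : nat -> R,
    forall N, series (fun n => `|g N n| ^+ 2) @ \oo --> l N.
  exists (fun N => limn (series (fun n => `|g N n| ^+ 2))) => N.
  have [l _ gl] := blaschke_prod_adj_energy _ (points_ball N) _ _ f0 fL.
  exact: (cvgP _ gl).
have rl N n : series (fun n => `|mt_remainder f N n| ^+ 2) n <= l N.
  apply: le_trans (blaschke_prod_energy_le _ (points_ball N) _ _) _.
  exact: energy_le_lim (gl N).
exists l => //.
have l0 N : 0 <= l N by apply: le_trans (rl N 0%N); rewrite /series /= big_geq.
have pair N : series (fun n => qconj (mt_remainder f N n) * f n) @ \oo -->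
    ((l N)%:A : H).
  have gg : series (fun n => qconj (g N n) * g N n) @ \oo --> ((l N)%:A : H).
    have -> : series (fun n => qconj (g N n) * g N n) =
        (fun n => (series (fun n => `|g N n| ^+ 2) n)%:A).
      apply/funext => n; rewrite /series /= scaler_suml; apply: eq_bigr => k _.
      by rewrite mul_qconj.
    by apply: cvgZr_tmp; exact: gl.
  exact: pairing_blaschke_prod (points_ball N) _ _ _ f0 (g0 N) gg.
(* Below M use the coefficients of the remainder; above M, the inequality
   x y <= (x^2 + y^2) / 2 bounds the pairing by half the tail of f plus half the
   energy of the remainder, and the latter is absorbed by the left side. *)
have lB N M : l N <= 2 * \sum_(0 <= m < M) `|mt_remainder f N m| * `|f m| +
    (L - series (fun n => `|f n| ^+ 2) M).
  set hd := \sum_(0 <= m < M) _; set tl := L - _.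
  suff : l N <= hd + (tl + l N) / 2 by lra.
  have /cvg_norm := pair N; rewrite normq_scalar ger0_norm // => /cvgr_to_le; apply.
  exists M => // n /= Mn; rewrite /series /= (big_cat_nat (leq0n M) Mn) //=.
  apply: le_trans (ler_normD _ _) _; apply: lerD.
    apply: le_trans (ler_norm_sum _ _ _) _; apply: ler_sum => m _.
    by rewrite normqM norm_qconj.
  apply: (@le_trans _ _ (\sum_(M <= m < n)
     (`|f m| ^+ 2 + `|mt_remainder f N m| ^+ 2) / 2)).
    apply: le_trans (ler_norm_sum _ _ _) _; apply: ler_sum => m _.
    rewrite normqM norm_qconj.
    by have := sqr_ge0 (`|f m| - `|mt_remainder f N m|); lra.
  rewrite -mulr_suml ler_wpM2r ?invr_ge0 // big_split /=; apply: lerD.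
    rewrite lerBrDl; apply: le_trans (energy_le_lim _ _ _ n fL).
    by rewrite [leRHS]/series /= (big_cat_nat (leq0n M) Mn).
  apply: le_trans (rl N n); rewrite [leRHS]/series /= (big_cat_nat (leq0n M) Mn) //= lerDr.
  by rewrite sumr_ge0 // => i _; rewrite exprn_ge0.
apply/cvgr0Pnorm_le => /= e e0.
have e2 : 0 < e / 2 by rewrite divr_gt0.
move/cvgrPdist_le/(_ _ e2) : (fL) => [M _ /(_ M (leqnn M)) fM].
have hd0 : (fun N => 2 * \sum_(0 <= m < M) `|mt_remainder f N m| * `|f m|) @ \oo --> 0.
  rewrite -[X in _ --> X](mulr0 2); apply: cvgMr; apply: cvg_sum0 => m.
  rewrite -[X in _ --> X](mul0r `|f m|); apply: cvgMl.
  exact: mt_remainder_coef_cvg0 f0 fL.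
move/cvgr0Pnorm_le/(_ _ e2) : hd0 => [K _ hdK].
exists K => // N /= KN; rewrite ger0_norm //.
apply: le_trans (lB N M) _; rewrite (splitr e); apply: lerD.
  by apply: le_trans (ler_norm _) _; exact: hdK.
exact: le_trans (ler_norm _) fM.
Qed.

End malmquist_takenaka_sequences.

(** * Slice regular functions and their coefficients *)

Section regular_functions.
Context {R : realType}.
Local Notation H := (quat R).
Local Notation pseries := (@Defs.pseries R).
Implicit Types (a q : H) (f g h : H -> H) (u v w : nat -> H).

Lemma expansion_of_pseries f w : has_expansion f w -> has_expansion (pseries w) w.
Proof. by move=> fw q q1; rewrite -(expansion_pseries f w q fw q1); exact: fw. Qed.

(** Polynomials, given by the list of their coefficients. *)
Lemma expansion_poly f (s : seq H) :
  (forall q, f q = \sum_(k < size s) q ^+ k * s`_k) -> has_expansion f (nth 0 s).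
Proof.
move=> fE q _; apply: cvg_near_cst; exists (size s) => // n /= sn.
have tail0 : \sum_(size s <= i < n) q ^+ i * s`_i = 0.
  rewrite big_nat big1 // => i /andP[si _].
  by rewrite nth_default ?mulr0.
by rewrite fE /series /= (big_cat_nat (leq0n _) sn) /= tail0 addr0 big_mkord.
Qed.

(** The function h only witnesses that the product series converges on the
    ball. *)
Lemma rmul_expansion f g h u v :
  has_expansion f u -> has_expansion g v -> has_expansion h (cprod u v) ->
  has_expansion (rmul f g) (cprod u v).
Proof.
move=> fu gv; rewrite /rmul (coef_expansion _ _ fu) (coef_expansion _ _ gv).
exact: expansion_of_pseries.
Qed.

Lemma bounded_rmul_expansion f g u v (C : R) :
  has_expansion f u -> has_expansion g v -> (forall n, `|cprod u v n| <= C) ->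
  has_expansion (rmul f g) (cprod u v).
Proof.
by move=> fu gv uvC; exact: rmul_expansion fu gv (pseries_bounded_expansion _ _ uvC).
Qed.

Lemma szego_coef_bounded a n : `|a| < 1 -> `|szego_coef a n| <= 1.
Proof. by move=> a1; rewrite normqX norm_qconj exprn_ile1 // ltW. Qed.

(** The geometric series S satisfies S = 1 + q S conj a. *)
Lemma szego_sum a q : `|a| < 1 -> `|q| < 1 ->
  pseries (szego_coef a) q - q * pseries (szego_coef a) q * qconj a = 1.
Proof.
move=> a1 q1; set S := pseries _ _.
have lim1 : series (fun n => q ^+ n * szego_coef a n) @ \oo --> S.
  by apply: (cvg_bounded_pseries 1) => // n; exact: szego_coef_bounded.
have := lim1; rewrite -cvg_shiftS => lim2.
have lim3 : (fun N => 1 + q * series (fun n => q ^+ n * szego_coef a n) N * qconj a)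
    @ \oo --> 1 + q * S * qconj a.
  by apply: cvgD; [exact: cvg_cst|apply: cvgqMr; exact: cvgqMl].
have eqs : (fun N => series (fun n => q ^+ n * szego_coef a n) N.+1) =
    (fun N => 1 + q * series (fun n => q ^+ n * szego_coef a n) N * qconj a).
  apply/funext => N; rewrite /series /= big_nat_recl // /szego_coef !expr0 mul1r.
  congr (_ + _); rewrite mulr_sumr mulr_suml; apply: eq_bigr => k _.
  by rewrite exprS exprSr !mulrA.
rewrite /= eqs in lim2.
by rewrite {1}(cvgq_unique lim2 lim3) addrK.
Qed.

Lemma symmetrization_mul (q a s : H) :
  (1 - q * (a + qconj a) + q ^+ 2 * (a * qconj a)) * s =
  (s - q * s * qconj a) - q * (s - q * s * qconj a) * a.
Proof.
rewrite expr2; case: q a s => ? ? ? ? [? ? ? ?] [? ? ? ?].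
by congr Quat => /=; ring.
Qed.

(** The symmetrization 1 - 2 q Re a + q^2 |a|^2 has real coefficients, hence
    commutes past right factors and turns the geometric series into 1 - q a. *)
Lemma szego_expansion a : `|a| < 1 -> has_expansion (szego a) (szego_coef a).
Proof.
move=> a1; set f := fun q : H => 1 - q * qconj a.
have fE : has_expansion f (nth 0 [:: 1; - qconj a]).
  apply: expansion_poly => q; rewrite !big_ord_recl big_ord0 /= expr0 expr1.
  by rewrite mul1r addr0 mulrN.
have cE : (fun n => qconj (nth 0 [:: 1; - qconj a] n)) = nth 0 [:: 1; - a].
  by apply/funext => -[|[|n]] /=; rewrite ?qconj1 ?qconjN ?qconjK // nth_nil qconj0.
have f'E : has_expansion (fun q : H => 1 - q * a) (nth 0 [:: 1; - a]).
  apply: expansion_poly => q; rewrite !big_ord_recl big_ord0 /= expr0 expr1.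
  by rewrite mul1r addr0 mulrN.
have rconjE : has_expansion (rconj f) (nth 0 [:: 1; - a]).
  by rewrite /rconj (coef_expansion _ _ fE) cE; exact: expansion_of_pseries f'E.
have sE : cprod (nth 0 [:: 1; - qconj a]) (nth 0 [:: 1; - a]) =
    nth 0 [:: 1; - (a + qconj a); a * qconj a].
  apply/funext => n; rewrite /cprod.
  case: n => [|[|n]]; rewrite !big_ord_recl ?big_ord0 /= ?mul1r ?mulr1 ?addr0 //.
    by rewrite opprD.
  rewrite big1 => [|i _]; last by rewrite mul0r.
  rewrite mul0r !addr0; case: n => [|n] /=.
    by rewrite mulrNN add0r mul_qconj mulq_conj.
  by rewrite !nth_nil mulr0 addr0.
pose D q : H := 1 - q * (a + qconj a) + q ^+ 2 * (a * qconj a).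
have DE : has_expansion D (nth 0 [:: 1; - (a + qconj a); a * qconj a]).
  apply: expansion_poly => q; rewrite !big_ord_recl big_ord0 /= expr0 expr1.
  by rewrite mul1r addr0 mulrN addrA.
rewrite -sE in DE.
have symE := rmul_expansion _ _ _ _ _ fE rconjE DE.
move=> q q1; rewrite /szego -/f /rrec /rsym.
rewrite (expansion_pseries _ _ _ symE q1) -(expansion_pseries _ _ _ DE q1).
rewrite (expansion_pseries _ _ _ rconjE q1) -(expansion_pseries _ _ _ f'E q1).
set S := pseries (szego_coef a) q.
have S1 : S - q * S * qconj a = 1 by exact: szego_sum.
have DS : D q * S = 1 - q * a.
  by rewrite /D symmetrization_mul S1 mulr1.
have D0 : D q != 0.
  apply: contraTneq (_ : `|q * a| < 1) => [D0|]; last first.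
    by rewrite normqM mulr_ilt1.
  rewrite D0 mul0r in DS; move/esym/subr0_eq: DS => <-.
  by rewrite normq1 ltxx.
rewrite -DS mulKr ?qunitE //.
by apply: (cvg_bounded_pseries 1) => // n; exact: szego_coef_bounded.
Qed.

Lemma blaschke_coefE a :
  cprod (szego_coef a) (nth 0 [:: - a; 1]) = blaschke_coef a.
Proof.
apply/funext => -[|n]; first by rewrite cprod0 /szego_coef expr0 mul1r.
rewrite /cprod !big_ord_recr /= subnn subSnn /= mulr1 big1 ?add0r => [|i _].
  rewrite mulrN /szego_coef exprSr -mulrA mul_qconj -scalerAr mulr1.
  by rewrite scalerBl scale1r.
have -> : (n.+1 - i)%N = (n - i).-1.+2 by have := ltn_ord i; lia.
by rewrite /= nth_nil mulr0.
Qed.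

Lemma blaschke_coef_bounded a n : `|a| < 1 -> `|blaschke_coef a n| <= 1.
Proof.
move=> a1; case: n => [|n] /=; first by rewrite normrN ltW.
have q0 : 0 <= 1 - `|a| ^+ 2 by rewrite subr_ge0 exprn_ile1 // ltW.
rewrite normrZ ger0_norm //; apply: mulr_ile1 => //.
exact: szego_coef_bounded.
Qed.

Lemma blaschke_expansion a : `|a| < 1 -> has_expansion (blaschke a) (blaschke_coef a).
Proof.
move=> a1; rewrite -blaschke_coefE; apply: (bounded_rmul_expansion _ _ _ _ 1).
- exact: szego_expansion.
- apply: expansion_poly => q; rewrite !big_ord_recl big_ord0 /= expr0 expr1.
  by rewrite mul1r mulr1 addr0 addrC.
- by move=> n; rewrite blaschke_coefE; exact: blaschke_coef_bounded.
Qed.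

Lemma cprod_blaschke_prod_bounded (l : seq H) u (C : R) :
  all (fun a => `|a| < 1) l -> (forall n, `|u n| <= C) ->
  exists D, forall n, `|cprod (blaschke_prod l) u n| <= D.
Proof.
move=> + uC; elim: l => [_|a l IH] /=; first by exists C; rewrite cprod1u.
move=> /andP[a1 /IH[D lD]]; rewrite blaschke_prod_cons -cprodA.
exact: cprod_blaschke_bounded a1 lD.
Qed.

(** The accumulator f is the product of the factors already multiplied, at the
    points of m. *)
Lemma foldl_rmul_blaschke f (l m : seq H) :
  all (fun a => `|a| < 1) l -> all (fun a => `|a| < 1) m ->
  has_expansion f (blaschke_prod m) ->
  has_expansion (foldl (@rmul R) f [seq blaschke a | a <- l]) (blaschke_prod (m ++ l)).
Proof.
elim: l m f => [|a l IH] m f /=; first by rewrite cats0.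
move=> /andP[a1 l1] m1 fm; rewrite -cat_rcons.
apply: IH => //; first by rewrite all_rcons a1.
rewrite blaschke_prod_rcons.
have [D aD] := cprod_blaschke_prod_bounded m _ 1 m1
  (fun n => blaschke_coef_bounded a n a1).
exact: bounded_rmul_expansion fm (blaschke_expansion a a1) aD.
Qed.

End regular_functions.

Section malmquist_takenaka_functions.
Context {R : realType}.
Local Notation H := (quat R).
Variable a : nat -> H.
Hypothesis ha : forall n, (1 <= n)%N -> `|a n| < 1.

Lemma malmquist_takenaka_expansion k : (1 <= k)%N ->
  has_expansion (malmquist_takenaka a k) (mt_coef a k).
Proof using ha.
case: k => [|k] // _; have ak1 := ha _ (ltn0Sn k).
rewrite /malmquist_takenaka /mt_coef /=; case: k ak1 => [|k] ak1 /=.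
  rewrite /points /= cprod1u; apply: expansionZ; exact: szego_expansion.
apply: expansionZ.
have bE : has_expansion (foldl (@rmul R) (blaschke (a 1%N))
    [seq blaschke (a k) | k <- index_iota 2 k.+2]) (blaschke_prod (points a k.+1)).
  have a11 := ha _ (ltn0Sn 0).
  have b1 : has_expansion (blaschke (a 1%N)) (blaschke_prod [:: a 1%N]).
    by rewrite /blaschke_prod /= cprod1u; exact: blaschke_expansion.
  have all1 : all (fun x => `|x| < 1) [:: a 1%N] by rewrite /= a11.
  have alll : all (fun x => `|x| < 1) [seq a j | j <- index_iota 2 k.+2].
    apply/allP => _ /mapP[j + ->]; rewrite mem_index_iota => /andP[j2 _].
    by apply: ha; lia.
  have := foldl_rmul_blaschke _ _ _ alll all1 b1; rewrite -map_comp.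
  by rewrite /points /index_iota !subSS !subn0.
have [D aD] := cprod_blaschke_prod_bounded _ _ 1 (points_ball _ ha k.+1)
  (fun n => szego_coef_bounded (a k.+2) n ak1).
exact: bounded_rmul_expansion bE (szego_expansion _ ak1) aD.
Qed.

Lemma hardy2_dot_malmquist_takenaka f u k : (1 <= k)%N ->
  has_expansion f u -> u @ \oo --> 0 ->
  hardy2_dot f (malmquist_takenaka a k) = mt_fourier a u k.
Proof using ha.
move=> k1 fu u0; apply: cvg_lim; first exact: norm_hausdorff.
rewrite (coef_expansion _ _ fu) (coef_expansion _ _ (malmquist_takenaka_expansion k k1)).
exact: mt_fourierE.
Qed.

Lemma mt_proj_expansion f u N : has_expansion f u -> u @ \oo --> 0 ->
  has_expansion (fun z => f z - mt_proj a N f z) (mt_remainder a u N).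
Proof using ha.
move=> fu u0.
have projE : has_expansion (mt_proj a N f)
    (fun n => \sum_(1 <= k < N.+1) mt_coef a k n * mt_fourier a u k).
  apply: (expansion_sum _ (fun k z => malmquist_takenaka a k z *
    hardy2_dot f (malmquist_takenaka a k))) => k.
  rewrite mem_index_iota => /andP[k1 _].
  rewrite (hardy2_dot_malmquist_takenaka _ _ _ k1 fu u0).
  by apply: expansionMr; exact: malmquist_takenaka_expansion.
have := expansionB _ _ _ _ fu projE.
congr has_expansion; apply/funext => n.
by rewrite {1}(mt_decomposition _ ha _ N u0) addrC addKr.
Qed.

End malmquist_takenaka_functions.

(** * Norm convergence and uniform convergence *)

Section norm_and_uniform_convergence.
Context {R : realType}.
Local Notation H := (quat R).
Local Notation pseries := (@Defs.pseries R).

Lemma nneseries_EFin (u : nat -> R) (L : R) :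
  (forall n, 0 <= u n) -> series u @ \oo --> L ->
  (\sum_(0 <= n <oo) (u n)%:E)%E = L%:E.
Proof.
move=> u0 uL; apply: cvg_lim => //.
have -> : (fun n => \sum_(0 <= i < n) (u i)%:E)%E = (fun n => (series u n)%:E).
  by apply/funext => n; rewrite sumEFin.
by apply: cvg_EFin => //; exact: nearW.
Qed.

Lemma square_summable_cvg (u : nat -> H) :
  (\sum_(0 <= n <oo) (`|u n| ^+ 2)%:E < +oo)%E ->
  exists L : R, series (fun n => `|u n| ^+ 2) @ \oo --> L.
Proof.
move=> ufin; apply/cvg_ex.
apply: nondecreasing_is_cvgn.
  by apply/nondecreasing_seqP => n; rewrite seriesSr lerDl exprn_ge0.
exists (fine (\sum_(0 <= n <oo) (`|u n| ^+ 2)%:E)%E) => _ [n _ <-].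
have nn k : (0 <= (`|u k| ^+ 2)%:E)%E by rewrite lee_fin exprn_ge0.
rewrite -lee_fin fineK; last first.
  by rewrite ge0_fin_numE // nneseries_ge0.
rewrite /series /= -sumEFin.
exact: (@nneseries_lim_ge _ (fun k => (`|u k| ^+ 2)%:E) xpredT 0).
Qed.

Lemma square_summable_cvg0 (u : nat -> H) (L : R) :
  series (fun n => `|u n| ^+ 2) @ \oo --> L -> u @ \oo --> 0.
Proof.
move=> /cvgP/cvg_series_cvg_0 u0; apply/norm_cvg0P.
have -> : (fun n => `|u n|) = (fun n => Num.sqrt (`|u n| ^+ 2)).
  by apply/funext => n; rewrite sqrtr_sqr normr_id.
rewrite -[X in _ --> X](sqrtr0 R).
by apply: (cvg_comp _ _ u0); exact: sqrt_continuous.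
Qed.

Lemma hardy2_norm_le (f : H -> H) (u : nat -> H) (E : R) :
  has_expansion f u -> (forall n, series (fun k => `|u k| ^+ 2) n <= E) ->
  (0 <= hardy2_norm f <= (Num.sqrt E)%:E)%E.
Proof.
move=> fu uE.
have cvu : cvgn (series (fun k => `|u k| ^+ 2)).
  apply: nondecreasing_is_cvgn; last by exists E => _ [n _ <-].
  by apply/nondecreasing_seqP => n; rewrite seriesSr lerDl exprn_ge0.
have -> : hardy2_norm f = (Num.sqrt (limn (series (fun k => `|u k| ^+ 2))))%:E.
  rewrite /hardy2_norm asboolT; last by exists u.
  rewrite (coef_expansion _ _ fu) (nneseries_EFin _ _ _ cvu).
    rewrite poweR_EFin powR12_sqrt //; apply: limr_ge => //.
    by apply: nearW => n; rewrite sumr_ge0 // => i _; rewrite exprn_ge0.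
  by move=> n; rewrite exprn_ge0.
by rewrite !lee_fin sqrtr_ge0 ler_wsqrtr // limr_le //; exact: nearW.
Qed.

(** The norm attains its maximum on K. *)
Lemma compact_ball_norm (K : set H) : compact K -> K `<=` @qball R ->
  exists2 rho : R, rho < 1 & forall z, K z -> `|z| <= rho.
Proof.
move=> Kc KB; have [->|/set0P K0] := eqVneq K set0; first by exists 0.
have [z|c cK zc] := @compact_EVT_max _ _ (fun z : H => `|z|) K K0 Kc.
  by apply: continuous_subspaceT => x; exact: norm_continuous.
exists `|c|; first by apply: KB; exact: set_mem.
by move=> z Kz; apply: zc; exact: mem_set.
Qed.

End norm_and_uniform_convergence.

Theorem mainTheorem4 (R : realType) (a : nat -> quat R)
  (ha : forall n : nat, (1 <= n)%N -> `|a n| < 1)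
  (hsum : (\sum_(1 <= n <oo) (1 - `|a n|)%:E)%E = +oo%E)
  (f : quat R -> quat R) (hf : hardy2 f) :
  (hardy2_norm (fun z => f z - mt_proj a n f z) @[n --> \oo] --> 0%E) /\
  (forall K : set (quat R), compact K -> K `<=` @qball R ->
     {uniform K, (fun n : nat => mt_proj a n f) @ \oo --> f}).
Proof.
have [_ [u fu ufin]] := hf.
have [L uL] := square_summable_cvg _ ufin.
have u0 := square_summable_cvg0 _ _ uL.
have div : series (fun n => 1 - `|a n.+1|) @ \oo --> +oo.
  apply/cvgeryP.
  have -> : (fun n => (series (fun n => 1 - `|a n.+1|) n)%:E) =
      (fun n => \sum_(1 <= k < n.+1) (1 - `|a k|)%:E)%E.
    by apply/funext => n; rewrite big_add1 sumEFin.
  rewrite -hsum (cvg_shiftS (fun n => \sum_(1 <= k < n) (1 - `|a k|)%:E)%E).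
  apply: is_cvg_nneseries => n n1 _; rewrite lee_fin subr_ge0 ltW //; exact: ha.
have [l l0 rl] := mt_remainder_energy_cvg0 _ ha div _ _ u0 uL.
have fE N := mt_proj_expansion _ ha _ _ N fu u0.
have sl0 : (fun N => Num.sqrt (l N)) @ \oo --> 0.
  rewrite -[X in _ --> X](sqrtr0 R).
  by apply: (cvg_comp _ _ l0); exact: sqrt_continuous.
split.
  apply: (@squeeze_cvge _ _ _ _ (fun=> 0%E) _ (fun N => (Num.sqrt (l N))%:E)).
  - by apply: nearW => N; exact: hardy2_norm_le (fE N) (rl N).
  - exact: cvg_cst.
  - by apply: cvg_EFin => //; exact: nearW.
move=> K Kc KB; have [rho rho1 Krho] := compact_ball_norm _ Kc KB.
have rho1' : 0 < 1 - rho by rewrite subr_gt0.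
have unif N z : K z -> `|f z - mt_proj a N f z| <= Num.sqrt (l N) / (1 - rho).
  move=> Kz; have z1 : `|z| < 1 by exact: KB.
  rewrite (expansion_pseries _ _ _ (fE N) z1).
  apply: le_trans (norm_pseries_le _ _ _ (norm_le_energy _ _ _ (rl N)) z1) _.
  rewrite ler_wpM2l // lef_pV2 ?posrE ?subr_gt0 // lerB //; exact: Krho.
move=> P /uniform_nbhs[E [entE EP]].
have [e /= e0 eE] := entE.
have bnd0 : (fun N => Num.sqrt (l N) / (1 - rho)) @ \oo --> 0.
  by rewrite -[X in _ --> X](mul0r (1 - rho)^-1); apply: cvgMl.
move/cvgr0Pnorm_lt/(_ _ e0) : bnd0 => [M _ hM].
exists M => // N MN; apply: EP => z Kz; apply: eE => /=.
(* The balls of the uniform structure are those of the norm, by conversion. *)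
change (`|f z - mt_proj a N f z| < e).
apply: le_lt_trans (unif N z Kz) _. apply: le_lt_trans (ler_norm _) _. exact: hM.
Qed.
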